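(* For $N\ge1$ let $U$ be an $N\times N$ unitary matrix chosen according to Haar measure on the unitary group $U(N)$, fix $\theta\in\mathbb{R}$, and let $Z(U,\theta)=\det(I-Ue^{-i\theta})$ be its characteristic polynomial. Then as $N\to\infty$ the distribution of the leading digits of $|Z(U,\theta)|$ converges to the Benford probabilities: for every base $B>1$ and every $s\in[1,B)$, $$\lim_{N\to\infty}\mathbb{P}\left(1\le M_B(|Z(U,\theta)|)\le s\right)=\log_B s,$$ where the probability is with respect to Haar measure on $U(N)$.
   Context: For $x>0$ the mantissa $M_B(x)\in[1,B)$ is defined by $x=M_B(x)B^k$ with $k\in\mathbb{Z}$, and $M_B(0)=0$. *)

(* Defs.v *)
From HB Require Import structures.
From mathcomp Require Import all_boot all_order all_algebra spectral.
From mathcomp Require Import complex.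
From mathcomp Require Import all_classical all_reals all_analysis.

Set Implicit Arguments.
Unset Strict Implicit.
Unset Printing Implicit Defensive.

Import Order.TTheory GRing.Theory Num.Theory.
Import numFieldNormedType.Exports.

Local Open Scope classical_set_scope.
Local Open Scope ring_scope.

Section unitary_group.
Variables (R : realType) (N : nat).

Record unitary : Type := Unitary {
  umx :> 'M[R[i]]_N;
  umxP : umx \is unitarymx }.

HB.instance Definition _ := [isSub for umx].
HB.instance Definition _ := [Choice of unitary by <:].

Lemma unitary1_subproof : (1%:M : 'M[R[i]]_N) \is unitarymx.
Proof. by apply/unitarymxP; rewrite mul1mx trmx1 map_mx1. Qed.

HB.instance Definition _ := isPointed.Build unitary (Unitary unitary1_subproof).

Lemma unitaryM_subproof (V U : unitary) : umx V *m umx U \is unitarymx.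
Proof. by apply: mul_unitarymx; exact: umxP. Qed.

Definition unitaryM (V U : unitary) : unitary :=
  Unitary (unitaryM_subproof V U).

(* The subspace topology inherited from the N x N complex matrices; the      *)
(* topology on the entries is that of the complex norm, which the library    *)
(* provides on the alias R[i]^o of R[i].                                     *)
HB.instance Definition _ :=
  Topological.copy unitary (initial_topology (umx : unitary -> 'M[R[i]^o]_N)).

Definition borel_unitary := g_sigma_algebraType (@open unitary).

HB.instance Definition _ := Measurable.on borel_unitary.

(* Haar measure on the compact group U(N), normalised to total mass 1: the   *)
(* (unique) left-invariant Borel probability measure.                        *)
Definition is_haar (mu : probability borel_unitary R) : Prop :=
  forall (V : unitary) (A : set borel_unitary),
    measurable A -> mu [set unitaryM V U | U in A] = mu A.

Definition charpolyZ (U : unitary) (theta : R) : R[i] :=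
  \det (1%:M - (cos (- theta) +i* sin (- theta))%C *: umx U).

End unitary_group.

Section mantissa.
Variable R : realType.

(* xget picks an element of the given set, which for 1 < B and 0 < x has     *)
(* exactly one element (see mantissaP and mantissaE).                        *)
Definition mantissa (B x : R) : R :=
  if 0 < x then
    xget 0 [set m : R | 1 <= m < B /\ exists k : int, x = m * B ^ k]
  else 0.

Lemma mantissaP (B x : R) : 1 < B -> 0 < x ->
  1 <= mantissa B x < B /\ exists k : int, x = mantissa B x * B ^ k.
Proof.
move=> B1 x0; rewrite /mantissa x0.
have B0 : 0 < B by exact: lt_trans B1.
have lB : 0 < ln B by exact: ln_gt0.
set P := [set _ | _]; suff [m Pm] : exists m, P m by exact: (xgetI 0 Pm).
pose k := Num.floor (ln x / ln B).
have Bk : 0 < B ^ k by rewrite exprz_gt0.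
have lnBz (j : int) : ln (B ^ j) = j%:~R * ln B.
  by rewrite -powR_intmul ?ln_powR// ltW.
exists (x / B ^ k); split; last by exists k; rewrite divfK// gt_eqF.
rewrite ler_pdivlMr// mul1r ltr_pdivrMr// -{2}[B]expr1z -expfzDr ?gt_eqF//.
rewrite -ler_ln ?posrE// -ltr_ln ?posrE ?exprz_gt0// !lnBz.
rewrite -ler_pdivlMr// -ltr_pdivrMr// floor_le/= addrC.
exact: floorD1_gt.
Qed.

Lemma mantissaE (B x m : R) (k : int) :
  1 < B -> 1 <= m < B -> x = m * B ^ k -> mantissa B x = m.
Proof.
move=> B1 /andP[m1 mB] xE.
have B0 : 0 < B by exact: lt_trans B1.
have x0 : 0 < x by rewrite xE mulr_gt0 ?exprz_gt0// (lt_le_trans _ m1).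
have [/andP[n1 nB] [l xE']] := mantissaP B1 x0.
set n := mantissa B x in n1 nB xE' *.
suff kl : k = l.
  have Bl : B ^ l != 0 by rewrite gt_eqF// exprz_gt0.
  by apply: (mulIf Bl); rewrite -xE' xE kl.
have aux (a b : R) (i j : int) : 1 <= a -> b < B -> a * B ^ i = b * B ^ j ->
    (i <= j)%R.
  move=> a1 bB E; rewrite -ltzD1 -(ltr_eXz2l B1).
  apply: (@le_lt_trans _ _ (a * B ^ i)).
    by rewrite ler_peMl// ltW// exprz_gt0.
  by rewrite E expfzDr ?gt_eqF// expr1z mulrC ltr_pM2l// exprz_gt0.
by apply/eqP; rewrite eq_le (aux m n)// ?(aux n m)// -?xE -?xE'.
Qed.

End mantissa.

(* Main.v *)
(** The law of U being invariant under multiplication by e^{-i theta}, take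
theta = 0. For U in U(n+1) with corner entry a and V in U(n), the Schur
complement gives det(1 - (1 (+) V) U) = (1 - a) det(1 - V W) with W unitary
depending on U only. By invariance of Haar measure |Z_{n+1}| is therefore
distributed as the product of independent copies of |1 - a| and |Z_n|, and the
characteristic function of log |Z_N| at t is a product of factors
E |1 - a_k|^{it}.

Since a and -a have the same law, the squared modulus of the k-th factor is at
most E cos^2((t/2) log(|1 - a| / |1 + a|)), which is about 1 - c E (Re a)^2.
The moments E (Re a)^2 = 1/(2k) and E (Re a)^4 <= 3/(k+2) E (Re a)^2 come from
invariance under reflections and multiplication by i. So the factors are at
most 1 - c'/k, and their product tends to 0 for t <> 0 because the harmonic
series diverges. Weyl's criterion for log_B |Z_N| mod 1 concludes; the arc
indicators are approximated by the polynomials (1 - x^m)^(2^m) in a cosine. *)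

Require Import Defs.
From HB Require Import structures.
From mathcomp Require Import all_boot all_order all_algebra spectral.
From mathcomp Require Import complex.
From mathcomp Require Import all_classical all_reals all_analysis.
From mathcomp Require Import measurable_realfun lebesgue_Rintegral ring lra.

Import Order.TTheory GRing.Theory Num.Theory.
Import numFieldNormedType.Exports.

Local Open Scope classical_set_scope.
Local Open Scope ring_scope.

Set Implicit Arguments.
Unset Strict Implicit.
Unset Printing Implicit Defensive.

(** * Bounded measurable functions *)

Section bounded_measurable.
Context (d : measure_display) (T : measurableType d) (R : realType).
Implicit Types f g : T -> R.

(** This class is closed under sums and products and is integrable for every probability measure, so
    integrability conditions below become structural. *)
Definition bmeas f :=
  measurable_fun setT f /\ exists M, forall x, `|f x| <= M.

Lemma bmeas_bound f (M : R) :
  measurable_fun setT f -> (forall x, `|f x| <= M) -> bmeas f.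
Proof. by move=> mf fM; split=> //; exists M. Qed.

Lemma bmeas_cst (c : R) : bmeas (fun=> c).
Proof. exact: (bmeas_bound (M := `|c|)). Qed.

Lemma bmeasD f g : bmeas f -> bmeas g -> bmeas (fun x => f x + g x).
Proof.
move=> [mf [M fM]] [mg [K gK]].
apply: (bmeas_bound (M := M + K)); first exact: measurable_funD.
by move=> x; apply: le_trans (ler_normD _ _) _; exact: lerD.
Qed.

Lemma bmeasM f g : bmeas f -> bmeas g -> bmeas (fun x => f x * g x).
Proof.
move=> [mf [M fM]] [mg [K gK]].
apply: (bmeas_bound (M := M * K)); first exact: measurable_funM.
by move=> x; rewrite normrM ler_pM.
Qed.

Lemma bmeasZ (c : R) f : bmeas f -> bmeas (fun x => c * f x).
Proof. by apply: bmeasM; exact: bmeas_cst. Qed.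

Lemma bmeasN f : bmeas f -> bmeas (fun x => - f x).
Proof.
move=> [mf [M fM]]; apply: (bmeas_bound (M := M)).
  exact: measurableT_comp.
by move=> x; rewrite normrN.
Qed.

Lemma bmeasB f g : bmeas f -> bmeas g -> bmeas (fun x => f x - g x).
Proof. by move=> bf bg; apply: bmeasD => //; exact: bmeasN. Qed.

Lemma bmeasX (n : nat) f : bmeas f -> bmeas (fun x => f x ^+ n).
Proof.
move=> bf; elim: n => [|n IH]; first exact: bmeas_cst.
by under [fun x => _]funext do rewrite exprS; exact: bmeasM.
Qed.

Lemma bmeas_sum (I : Type) (r : seq I) (F : I -> T -> R) :
  (forall i, bmeas (F i)) -> bmeas (fun x => \sum_(i <- r) F i x).
Proof.
move=> bF; elim: r => [|i r IH].
  by under [fun x => _]funext do rewrite big_nil; exact: bmeas_cst.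
by under [fun x => _]funext do rewrite big_cons; exact: bmeasD.
Qed.

Variable mu : probability T R.

Lemma bmeas_integrable f : bmeas f -> mu.-integrable setT (EFin \o f).
Proof.
move=> [mf [M fM]]; apply: measurable_bounded_integrable => //.
  by apply: le_lt_trans (probability_le1 mu measurableT) _; rewrite ltry.
exists M; split; rewrite ?num_real// => x Mx y _ /=.
exact: le_trans (fM y) (ltW Mx).
Qed.

Lemma prob_intD f g : bmeas f -> bmeas g ->
  \int[mu]_x (f x + g x) = \int[mu]_x f x + \int[mu]_x g x.
Proof. by move=> bf bg; rewrite RintegralD//; exact: bmeas_integrable. Qed.

Lemma prob_intB f g : bmeas f -> bmeas g ->
  \int[mu]_x (f x - g x) = \int[mu]_x f x - \int[mu]_x g x.
Proof. by move=> bf bg; rewrite RintegralB//; exact: bmeas_integrable. Qed.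

Lemma prob_intZ (c : R) f : bmeas f ->
  \int[mu]_x (c * f x) = c * \int[mu]_x f x.
Proof. by move=> bf; rewrite RintegralZl//; exact: bmeas_integrable. Qed.

Lemma prob_int_cst (c : R) : \int[mu]_x c = c.
Proof. by rewrite Rintegral_cst//= (probability_setT mu) mulr1. Qed.

Lemma prob_int_le f g : bmeas f -> bmeas g -> (forall x, f x <= g x) ->
  \int[mu]_x f x <= \int[mu]_x g x.
Proof.
by move=> bf bg fg; apply: le_Rintegral => //; exact: bmeas_integrable.
Qed.

Lemma prob_int_sum (I : Type) (r : seq I) (F : I -> T -> R) :
  (forall i, bmeas (F i)) ->
  \int[mu]_x (\sum_(i <- r) F i x) = \sum_(i <- r) \int[mu]_x F i x.
Proof.
move=> bF; elim: r => [|i r IH].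
  by under eq_Rintegral do rewrite big_nil; rewrite prob_int_cst big_nil.
under eq_Rintegral do rewrite big_cons.
by rewrite prob_intD// ?IH ?big_cons//; exact: bmeas_sum.
Qed.

Lemma prob_int_indic (A : set T) : measurable A ->
  (\int[mu]_x (\1_A x : R))%:E = mu A.
Proof.
move=> mA; rewrite /Rintegral integral_indic// setIT fineK//.
exact: fin_num_measure.
Qed.

(* The variance of [f] is nonnegative. *)
Lemma prob_int_sqr f : bmeas f ->
  (\int[mu]_x f x) ^+ 2 <= \int[mu]_x (f x ^+ 2).
Proof.
move=> bf; set m := \int[mu]_x f x.
have b2 : bmeas (fun x => f x ^+ 2) by exact: bmeasX.
have bm : bmeas (fun x => (2 * m) * f x) by exact: bmeasZ.
have : \int[mu]_x ((f x ^+ 2 - (2 * m) * f x) + m ^+ 2) >= 0.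
  apply: Rintegral_ge0 => x _.
  have -> : f x ^+ 2 - 2 * m * f x + m ^+ 2 = (f x - m) ^+ 2 by ring.
  exact: sqr_ge0.
have bc := bmeas_cst (m ^+ 2); have bB := bmeasB b2 bm.
by rewrite prob_intD// prob_intB// prob_intZ// prob_int_cst -/m => h; nra.
Qed.

End bounded_measurable.

Lemma prob_int_pushforward d1 d2 (T1 : measurableType d1)
    (T2 : measurableType d2) (R : realType) (mu1 : probability T1 R)
    (mu2 : probability T2 R) (phi : T1 -> T2) (f : T2 -> R) :
  measurable_fun setT phi ->
  (forall A, measurable A -> mu1 (phi @^-1` A) = mu2 A) ->
  bmeas f -> \int[mu1]_x f (phi x) = \int[mu2]_y f y.
Proof.
move=> mphi E bf; congr fine.
transitivity (\int[pushforward mu1 phi]_y (f y)%:E)%E; last first.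
  by apply: eq_measure_integral => A mA _; exact: E.
have [mf [M fM]] := bf.
have bfp : bmeas (f \o phi).
  apply: (bmeas_bound (M := M)) => [|x]; last exact: fM.
  exact: measurableT_comp.
rewrite (integral_pushforward mphi)//; first exact/measurable_EFinP.
by rewrite preimage_setT; exact: (bmeas_integrable mu1 bfp).
Qed.

Lemma prob_int_Fubini d1 d2 (T1 : measurableType d1)
    (T2 : measurableType d2) (R : realType) (mu1 : probability T1 R)
    (mu2 : probability T2 R) (f : T1 * T2 -> R) :
  bmeas f ->
  \int[mu1]_x \int[mu2]_y f (x, y) = \int[mu2]_y \int[mu1]_x f (x, y).
Proof.
move=> [mf [M fM]].
have fP : (mu1 \x mu2)%E.-integrable setT (EFin \o f).
  apply: measurable_bounded_integrable => //.
    rewrite -setXTT [ltLHS](product_measure1E mu1 mu2 measurableT measurableT).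
    by rewrite /= (probability_setT mu1) (probability_setT mu2) mule1 ltry.
  exists M; split; rewrite ?num_real// => x Mx y _ /=.
  exact: le_trans (fM y) (ltW Mx).
congr fine.
(* The inner integrals are finite, so taking finite parts loses nothing and Fubini for extended
   reals applies. *)
transitivity (\int[mu1]_x (\int[mu2]_y (EFin \o f) (x, y)))%E.
  apply: eq_integral => x _; rewrite fineK//.
  have /(bmeas_integrable mu2) : bmeas (fun y => f (x, y)).
    apply: (bmeas_bound (M := M)) => //; exact: measurableT_comp.
  exact: integrable_fin_num.
rewrite Fubini//; apply: eq_integral => y _; rewrite /Rintegral fineK//.
have /(bmeas_integrable mu1) : bmeas (fun x => f (x, y)).
  apply: (bmeas_bound (M := M)) => //; exact: measurableT_comp.
exact: integrable_fin_num.
Qed.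

(** * Measurability of complex-valued functions *)

Section complex_measurable.
Context (d : measure_display) (T : measurableType d) (R : realType).
Implicit Types f g : T -> R[i].

(** Phrased through the two real coordinates, so that only the Borel sets of [R] enter; sums and
    products, hence determinants, stay in the class. *)
Definition cmeas f :=
  measurable_fun setT (fun x => complex.Re (f x)) /\
  measurable_fun setT (fun x => complex.Im (f x)).

Lemma cmeas_cst (c : R[i]) : cmeas (fun=> c).
Proof. by split; exact: measurable_cst. Qed.

Lemma Re_addc (x y : R[i]) : complex.Re (x + y) = complex.Re x + complex.Re y.
Proof. by case: x y => [a b] [c e]. Qed.

Lemma Im_addc (x y : R[i]) : complex.Im (x + y) = complex.Im x + complex.Im y.
Proof. by case: x y => [a b] [c e]. Qed.

Lemma Re_oppc (x : R[i]) : complex.Re (- x) = - complex.Re x.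
Proof. by case: x. Qed.

Lemma Im_oppc (x : R[i]) : complex.Im (- x) = - complex.Im x.
Proof. by case: x. Qed.

Lemma Re_mulc (x y : R[i]) : complex.Re (x * y) =
  complex.Re x * complex.Re y - complex.Im x * complex.Im y.
Proof. by case: x y => [a b] [c e]. Qed.

Lemma Im_mulc (x y : R[i]) : complex.Im (x * y) =
  complex.Re x * complex.Im y + complex.Im x * complex.Re y.
Proof. by case: x y => [a b] [c e]. Qed.

Lemma cmeasD f g : cmeas f -> cmeas g -> cmeas (fun x => f x + g x).
Proof.
move=> [f1 f2] [g1 g2]; split.
  by under [fun x => _]funext do rewrite Re_addc; exact: measurable_funD.
by under [fun x => _]funext do rewrite Im_addc; exact: measurable_funD.
Qed.

Lemma cmeasN f : cmeas f -> cmeas (fun x => - f x).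
Proof.
move=> [f1 f2]; split.
  by under [fun x => _]funext do rewrite Re_oppc; exact: measurable_funN.
by under [fun x => _]funext do rewrite Im_oppc; exact: measurable_funN.
Qed.

Lemma cmeasM f g : cmeas f -> cmeas g -> cmeas (fun x => f x * g x).
Proof.
move=> [f1 f2] [g1 g2]; split.
  under [fun x => _]funext do rewrite Re_mulc.
  by apply: measurable_funB; exact: measurable_funM.
under [fun x => _]funext do rewrite Im_mulc.
by apply: measurable_funD; exact: measurable_funM.
Qed.

Lemma cmeas_sum (I : Type) (r : seq I) (F : I -> T -> R[i]) :
  (forall i, cmeas (F i)) -> cmeas (fun x => \sum_(i <- r) F i x).
Proof.
move=> bF; elim: r => [|i r IH].
  by under [fun x => _]funext do rewrite big_nil; exact: cmeas_cst.
by under [fun x => _]funext do rewrite big_cons; exact: cmeasD.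
Qed.

Lemma cmeas_prod (I : Type) (r : seq I) (F : I -> T -> R[i]) :
  (forall i, cmeas (F i)) -> cmeas (fun x => \prod_(i <- r) F i x).
Proof.
move=> bF; elim: r => [|i r IH].
  by under [fun x => _]funext do rewrite big_nil; exact: cmeas_cst.
by under [fun x => _]funext do rewrite big_cons; exact: cmeasM.
Qed.

Lemma cmeas_det (n : nat) (M : T -> 'M[R[i]]_n) :
  (forall i j, cmeas (fun x => M x i j)) -> cmeas (fun x => \det (M x)).
Proof.
move=> mM; apply: cmeas_sum => s; apply: cmeasM; first exact: cmeas_cst.
by apply: cmeas_prod => i.
Qed.

Lemma normc_ge0 (z : R[i]) : 0 <= Normc.normc z.
Proof. by case: z => a b; exact: sqrtr_ge0. Qed.

Lemma sqr_normcE (z : R[i]) :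
  Normc.normc z ^+ 2 = complex.Re z ^+ 2 + complex.Im z ^+ 2.
Proof. by case: z => a b /=; rewrite sqr_sqrtr// addr_ge0// sqr_ge0. Qed.

Lemma measurable_normc f : cmeas f -> measurable_fun setT (fun x => Normc.normc (f x)).
Proof.
move=> [f1 f2].
rewrite (_ : (fun x => _) = (@Num.sqrt R) \o
    (fun x => complex.Re (f x) ^+ 2 + complex.Im (f x) ^+ 2)); last first.
  by apply/funext => x /=; case: (f x).
apply: measurableT_comp.
  by apply: continuous_measurable_fun; exact: sqrt_continuous.
by apply: measurable_funD; exact: measurable_funX.
Qed.

End complex_measurable.

Lemma cmeas_comp d1 d2 (T1 : measurableType d1) (T2 : measurableType d2)
    (R : realType) (phi : T1 -> T2) (f : T2 -> R[i]) :
  measurable_fun setT phi -> cmeas f -> cmeas (fun x => f (phi x)).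
Proof.
move=> mphi [f1 f2].
split; [exact: (measurableT_comp f1 mphi)|exact: (measurableT_comp f2 mphi)].
Qed.

(** * Haar measure on the unitary group *)

Local Open Scope sesquilinear_scope.

Section unitary_measurable.
Variables (R : realType) (N : nat).

Lemma umx_continuous : continuous (@umx R N : unitary R N -> 'M[R[i]^o]_N).
Proof. exact: initial_continuous. Qed.

Lemma entry_continuous (i j : 'I_N) :
  continuous (fun U : unitary R N => umx U i j : R[i]^o).
Proof.
move=> U; apply: (@continuous_comp _ _ _ (@umx R N : _ -> 'M[R[i]^o]_N)
  (fun M : 'M[R[i]^o]_N => M i j)).
  exact: umx_continuous.
exact: coord_continuous.
Qed.

Lemma Re_continuous : continuous (@complex.Re R : R[i]^o -> R).
Proof.
move=> z A /nbhs_ballP[e /= e0 eA].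
suff : nbhs (z : R[i]^o) (@complex.Re R @^-1` A) by [].
apply/nbhs_ballP; exists (e%:C)%C; first by rewrite /= ltcR.
move=> w; rewrite -ball_normE /= => zw; apply: eA.
rewrite -ball_normE /= -ltcR; apply: le_lt_trans zw.
by rewrite -Re_oppc -Re_addc normc_ge_Re.
Qed.

Lemma Im_continuous : continuous (@complex.Im R : R[i]^o -> R).
Proof.
move=> z A /nbhs_ballP[e /= e0 eA].
suff : nbhs (z : R[i]^o) (@complex.Im R @^-1` A) by [].
apply/nbhs_ballP; exists (e%:C)%C; first by rewrite /= ltcR.
move=> w; rewrite -ball_normE /= => zw; apply: eA.
rewrite -ball_normE /= -ltcR; apply: le_lt_trans zw.
(* Since Im v = Re (- i v), the bound on real parts suffices. *)
rewrite -Im_oppc -Im_addc -(_ : complex.Re (- ('i%C * (z - w))) = complex.Im (z - w)).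
  apply: le_trans (normc_ge_Re _) _.
  by rewrite normrN normrM normc_def /= expr0n expr1n add0r sqrtr1 mul1r.
by rewrite Re_oppc Re_mulc /= mul0r mul1r sub0r opprK.
Qed.

Lemma continuous_borel_unitary (f : unitary R N -> R) :
  continuous f -> measurable_fun setT (f : borel_unitary R N -> R).
Proof.
move=> /continuousP cf; apply: (measurability _ (RGenOpens.measurableE R)).
move=> _ [_ [a [b ->] <-]]; rewrite setTI; apply: sub_sigma_algebra.
by apply: cf; exact: interval_open.
Qed.

Lemma cmeas_entry (i j : 'I_N) : cmeas (fun U : borel_unitary R N => umx U i j).
Proof.
pose e (U : unitary R N) : R[i]^o := umx U i j.
split.
- apply: (continuous_borel_unitary (f := @complex.Re R \o e)) => U.
  by apply: continuous_comp; [exact: entry_continuous|exact: Re_continuous].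
- apply: (continuous_borel_unitary (f := @complex.Im R \o e)) => U.
  by apply: continuous_comp; [exact: entry_continuous|exact: Im_continuous].
Qed.

Lemma unitaryM_continuous (V : unitary R N) : continuous (unitaryM V).
Proof.
apply/continuousP => _ [A oA <-].
rewrite -comp_preimage.
have cV : continuous (fun U : unitary R N => umx (unitaryM V U) : 'M[R[i]^o]_N).
  (* A neighbourhood of a matrix contains a product [P] of neighbourhoods of its entries, and each
     entry of the product is linear in the entries of [W]. *)
  move=> U B [P PU PB].
  have PV : forall i j, \forall W \near U, P i j (umx (unitaryM V W) i j).
    move=> i j; apply: (_ : continuous (fun W : unitary R N =>
        (umx (unitaryM V W) i j : R[i]^o))) (PU i j).
    rewrite (_ : (fun W => _) = fun W : unitary R N =>
        \sum_k ((V i k : R[i]^o) * (W k j : R[i]^o))); last first.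
      by apply/funext => W; rewrite mxE.
    apply: continuous_big => [|k _ W]; first exact: add_continuous.
    apply: (@continuous_comp _ _ _ (fun W0 : unitary R N => W0 k j : R[i]^o)
      (fun z : R[i]^o => (V i k : R[i]^o) * z)); first exact: entry_continuous.
    exact: mulrl_continuous.
  have FU : Filter (nbhs (U : unitary R N)) by exact: nbhs_filter.
  have : nbhs (U : unitary R N)
      [set W | forall i j, P i j (umx (unitaryM V W) i j)].
    apply: (@filter_forall _ _ _ _ FU) => i; apply: (@filter_forall _ _ _ _ FU) => j.
    exact: PV.
  by apply: filterS => W PW; exact: PB.
by move/continuousP : cV; apply.
Qed.

Lemma measurable_unitaryM (V : unitary R N) :
  measurable_fun setT (unitaryM V : borel_unitary R N -> borel_unitary R N).
Proof.
apply: (@measurability _ _ (borel_unitary R N) (borel_unitary R N) _ _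
  (@open (unitary R N)) erefl) => _ [A oA <-].
rewrite setTI; apply: sub_sigma_algebra.
by have /continuousP := @unitaryM_continuous V; apply.
Qed.

Lemma unitary_mulC (U : unitary R N) : (umx U)^t* *m umx U = 1%:M.
Proof. by apply: mulmx1C; apply/unitarymxP; exact: umxP. Qed.

Lemma unitaryV_subproof (V : unitary R N) : (umx V)^t* \is unitarymx.
Proof. by rewrite trmxC_unitary umxP. Qed.

Definition unitaryV (V : unitary R N) := Unitary (unitaryV_subproof V).

Lemma unitary_inj (U V : unitary R N) : umx U = umx V -> U = V.
Proof. exact: val_inj. Qed.

Lemma unitaryMK (V : unitary R N) : cancel (unitaryM V) (unitaryM (unitaryV V)).
Proof.
by move=> U; apply: unitary_inj; rewrite /= mulmxA unitary_mulC mul1mx.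
Qed.

Lemma unitaryVK (V : unitary R N) : cancel (unitaryM (unitaryV V)) (unitaryM V).
Proof.
move=> U; apply: unitary_inj.
by rewrite /= mulmxA (unitarymxP (umxP V)) mul1mx.
Qed.

Variable mu : probability (borel_unitary R N) R.
Hypothesis muP : is_haar mu.

(** [is_haar] speaks of images; the preimage under [V] is the image under its inverse. *)
Lemma haar_preimage (V : unitary R N) (A : set (borel_unitary R N)) :
  measurable A -> mu (unitaryM V @^-1` A) = mu A.
Proof.
move=> mA; rewrite -[RHS](muP (unitaryV V) mA); congr (mu _).
apply/seteqP; split => [U AU|_ [U AU <-]] /=; last by rewrite unitaryVK.
by exists (unitaryM V U) => //; rewrite unitaryMK.
Qed.

Lemma haar_int (V : unitary R N) (f : borel_unitary R N -> R) : bmeas f ->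
  \int[mu]_U f (unitaryM V U) = \int[mu]_U f U.
Proof.
move=> bf; apply: prob_int_pushforward => //; first exact: measurable_unitaryM.
exact: haar_preimage.
Qed.

End unitary_measurable.

(** * The recursion for the characteristic polynomial *)

Section unitary_algebra.
Variable R : realType.

Lemma sqr_normC_real (z : R[i]) : z * Num.conj z = ((Normc.normc z ^+ 2)%:C)%C.
Proof. by rewrite -normCK rmorphXn /=; congr (_ ^+ 2); rewrite normc_def; case: z. Qed.

Lemma unitary_row_norm (n : nat) (U : unitary R n) (i : 'I_n) :
  \sum_j Normc.normc (U i j) ^+ 2 = 1.
Proof.
have /matrixP/(_ i i) := unitarymxP (umxP U).
rewrite !mxE eqxx => E.
suff : ((\sum_j Normc.normc (U i j) ^+ 2)%:C = 1%:C)%C by case.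
rewrite rmorph_sum /= -[RHS]E; apply: eq_bigr => j _.
by rewrite !mxE -sqr_normC_real.
Qed.

Lemma unitary_col_norm (n : nat) (U : unitary R n) (j : 'I_n) :
  \sum_i Normc.normc (U i j) ^+ 2 = 1.
Proof.
have /matrixP/(_ j j) := unitary_mulC U.
rewrite !mxE eqxx => E.
suff : ((\sum_i Normc.normc (U i j) ^+ 2)%:C = 1%:C)%C by case.
rewrite rmorph_sum /= -[RHS]E; apply: eq_bigr => i _.
by rewrite !mxE mulrC -sqr_normC_real.
Qed.

Lemma unitary_entry_le1 (n : nat) (U : unitary R n) (i j : 'I_n) :
  Normc.normc (U i j) <= 1.
Proof.
rewrite -(@ler_pXn2r _ 2)// ?nnegrE ?normc_ge0// expr1n.
rewrite -(unitary_row_norm U i) (bigD1 j)//= lerDl.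
by apply: sumr_ge0 => k _; exact: sqr_ge0.
Qed.

(** Compare determinants in (1 - V W) V = V (1 - W V) and cancel det V. *)
Lemma det_1subC (n : nat) (V W : 'M[R[i]]_n) : V \in unitmx ->
  \det (1%:M - V *m W) = \det (1%:M - W *m V).
Proof.
move=> Vu; have dV : \det V != 0 by rewrite -unitfE -unitmxE.
apply: (mulIf dV); rewrite -det_mulmx mulrC -det_mulmx; congr (\det _).
by rewrite mulmxBl mulmxBr mul1mx mulmx1 mulmxA.
Qed.

Variable n : nat.

Lemma ulift_subproof (V : unitary R n) :
  (block_mx (1%:M : 'M[R[i]]_1) 0 0 (umx V) : 'M[R[i]]_(1 + n)) \is unitarymx.
Proof.
apply/unitarymxP.
rewrite (tr_block_mx (1%:M : 'M[R[i]]_1)) map_block_mx !trmx0 !map_mx0.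
rewrite mulmx_block !mul0mx !mulmx0 !addr0 add0r trmx1 map_mx1 mul1mx.
by rewrite (unitarymxP (umxP V)) -scalar_mx_block.
Qed.

Definition ulift (V : unitary R n) : unitary R n.+1 := Unitary (ulift_subproof V).

(** [W] is D + c b / (1 - z), z being the corner entry. It is fixed before [V], so invariance of
    Haar measure in [V] can absorb it later. *)
Lemma charpoly_rec (U : unitary R n.+1) : exists W : unitary R n,
  forall V : unitary R n, \det (1%:M - umx (unitaryM (ulift V) U)) =
    (1 - U ord0 ord0) * \det (1%:M - umx (unitaryM W V)).
Proof.
pose M : 'M[R[i]]_(1 + n) := umx U.
pose a := ulsubmx M; pose b := ursubmx M.
pose c := dlsubmx M; pose D := drsubmx M.
have ME : M = block_mx a b c D by rewrite submxK.
set z := U ord0 ord0.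
have aE : a = z%:M.
  by rewrite [a]mx11_scalar /a !mxE !lshift0.
have Muni : M *m M^t* = 1%:M by exact: (unitarymxP (umxP U)).
have Muni' : M^t* *m M = 1%:M by exact: mulmx1C.
have E V : (1%:M - umx (unitaryM (ulift V) U) : 'M[R[i]]_(1 + n)) =
    block_mx (1%:M - a) (- b) (- (umx V *m c)) (1%:M - umx V *m D).
  transitivity (block_mx 1%:M 0 0 1%:M - block_mx a b (umx V *m c) (umx V *m D)).
    congr (_ - _); first exact: scalar_mx_block.
    transitivity (block_mx (1%:M : 'M[R[i]]_1) 0 0 (umx V) *m block_mx a b c D).
      by rewrite -ME.
    by rewrite mulmx_block !mul0mx !mul1mx !addr0 !add0r.
  by rewrite opp_block_mx add_block_mx !add0r.
(* If the corner entry is 1, the rest of the first row of [U] vanishes because rows have norm 1;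
   both sides are then 0 and any [W] serves. *)
have [z1|z1] := eqVneq z 1.
  exists (Unitary (@unitary1_subproof R n)) => V.
  rewrite z1 subrr mul0r.
  have b0 : b = 0.
    have U0 : \sum_(j | j != ord0) Normc.normc (U ord0 j) ^+ 2 = 0.
      have := unitary_row_norm U ord0; rewrite (bigD1 ord0)//= -/z z1.
      by rewrite Normc.normc1 expr1n -[RHS]addr0 => /addrI.
    apply/matrixP => i j; rewrite !mxE ord1.
    have := psumr_eq0P (fun k _ => sqr_ge0 _) U0 => /(_ (rshift 1 j) isT) /eqP.
    by rewrite expf_eq0 /= lshift0 => /eqP /Normc.eq0_normc.
  rewrite [X in \det X]E aE z1 b0 subrr oppr0 (det_lblock (0 : 'M[R[i]]_1)).
  by rewrite det_mx11 mxE mul0r.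
have z0 : 1 - z != 0 by rewrite subr_eq0 eq_sym.
pose r := (1 - z)^-1; pose W := D + r *: (c *m b).
have rE : z * r + 1 = r.
  by apply: (mulIf z0); rewrite mulrDl -mulrA mulVf// mulr1 mul1r addrC subrK.
have Wuni : W \is unitarymx.
  apply/unitarymxP; apply: mulmx1C.
  (* [M] maps [K] to the column (r b, W), the upper block being fixed as z r + 1 = r. Since [M]
     preserves Gram matrices, the contribution of r b cancels and [W] has Gram matrix 1. *)
  pose K : 'M[R[i]]_(1 + n, n) := col_mx (r *: b) 1%:M.
  have MK : M *m K = col_mx (r *: b) W.
    rewrite ME mul_block_col !mulmx1 aE mul_scalar_mx scalerA -[X in _ + X]scale1r.
    by rewrite -scalerDl rE -scalemxAr addrC.
  have : (M *m K)^t* *m (M *m K) = K^t* *m K.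
    by rewrite trmx_mul map_mxM /= -!mulmxA (mulmxA _ M K) Muni' mul1mx.
  rewrite MK /K !tr_col_mx !map_row_mx !mul_row_col => /addrI ->.
  by rewrite trmx1 map_mx1 mul1mx.
exists (Unitary Wuni) => V /=.
rewrite -(@det_1subC _ (umx V) W); last exact/unitarymx_unit/umxP.
(* Block elimination with pivot 1 - z: its Schur complement 1 - V D - r V c b equals 1 - V W. *)
pose L : 'M[R[i]]_(1 + n) := block_mx (1 - z)%:M 0 (- (umx V *m c)) 1%:M.
pose K : 'M[R[i]]_(1 + n) := block_mx 1%:M (- (r *: b)) 0 (1%:M - umx V *m W).
rewrite [X in \det X = _](_ : _ = L *m K).
  rewrite det_mulmx [\det L](det_lblock (1 - z)%:M) [\det K](det_ublock (1%:M : 'M[R[i]]_1)).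
  by rewrite !det_scalar !expr1n expr1 mulr1 mul1r.
rewrite [LHS]E /L /K mulmx_block !mul0mx !mulmx0 !mulmx1 !mul1mx !addr0 aE.
congr block_mx.
- by rewrite raddfB.
- by rewrite mul_scalar_mx scalerN scalerA divff// scale1r.
- rewrite /W mulmxDr -scalemxAr mulNmx mulmxN opprK -scalemxAr mulmxA opprD.
  by rewrite [RHS]addrC -!addrA addNr addr0.
Qed.

End unitary_algebra.

Section charpoly_recursion.
Variable R : realType.

Definition unitaryZ (n : nat) (U : unitary R n) : R :=
  Normc.normc (\det (1%:M - umx U)).

Definition corner (n : nat) (U : unitary R n.+1) : R :=
  Normc.normc (1 - U ord0 ord0).

Lemma unitaryZ_ge0 (n : nat) (U : unitary R n) : 0 <= unitaryZ U.
Proof. exact: normc_ge0. Qed.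

Lemma corner_ge0 (n : nat) (U : unitary R n.+1) : 0 <= corner U.
Proof. exact: normc_ge0. Qed.

Lemma measurable_unitaryZ (n : nat) :
  measurable_fun setT (@unitaryZ n : borel_unitary R n -> R).
Proof.
apply: measurable_normc; apply: cmeas_det => i j.
under [fun x => _]funext do rewrite mxE [X in _ + X]mxE.
by apply: cmeasD; [exact: cmeas_cst|exact/cmeasN/cmeas_entry].
Qed.

Lemma measurable_corner (n : nat) :
  measurable_fun setT (@corner n : borel_unitary R n.+1 -> R).
Proof.
apply: measurable_normc.
by apply: cmeasD; [exact: cmeas_cst|exact/cmeasN/cmeas_entry].
Qed.

Lemma bmeas_comp (d : measure_display) (T : measurableType d)
    (phi : T -> R) (f : R -> R) :
  measurable_fun setT phi -> bmeas f -> bmeas (fun x => f (phi x)).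
Proof.
move=> mphi [mf [M fM]]; apply: (bmeas_bound (M := M)) => [|x]; last exact: fM.
exact: measurableT_comp.
Qed.

Lemma cmeas_ulift (n : nat) (i j : 'I_n.+1) :
  cmeas (fun V : borel_unitary R n => umx (ulift V) i j).
Proof.
rewrite /= /block_mx /col_mx /row_mx.
under [fun x => _]funext do rewrite mxE.
case: (fintype.split (i : 'I_(1 + n))) => i';
  under [fun x => _]funext do rewrite mxE;
  case: (fintype.split (j : 'I_(1 + n))) => j'; [exact: cmeas_cst.. |exact: cmeas_entry].
Qed.

Lemma measurable_unitaryZ_ulift (n : nat) :
  measurable_fun setT (fun x : borel_unitary R n.+1 * borel_unitary R n =>
    unitaryZ (unitaryM (ulift x.2) x.1)).
Proof.
apply: measurable_normc; apply: cmeas_det => i j.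
under [fun x => _]funext do rewrite mxE [X in _ + X]mxE [X in - X]mxE.
apply: cmeasD; first exact: cmeas_cst.
apply: cmeasN; apply: cmeas_sum => k; apply: cmeasM.
  exact: (cmeas_comp measurable_snd (cmeas_ulift i k)).
exact: (cmeas_comp measurable_fst (cmeas_entry R k j)).
Qed.

Variable n : nat.
Variable mu1 : probability (borel_unitary R n.+1) R.
Variable mu : probability (borel_unitary R n) R.
Hypothesis mu1P : is_haar mu1.
Hypothesis muP : is_haar mu.

(** Invariance in [U] inserts a factor [ulift V], which is then averaged over [V]; after Fubini, for
    fixed [U], invariance in [V] removes [W]. *)
Lemma unitaryZ_int_rec (f : R -> R) : bmeas f ->
  \int[mu1]_U f (unitaryZ U) =
  \int[mu1]_U \int[mu]_V f (corner U * unitaryZ V).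
Proof.
move=> bf; have bfZ := bmeas_comp (@measurable_unitaryZ n.+1) bf.
pose F (x : borel_unitary R n.+1 * borel_unitary R n) :=
  f (unitaryZ (unitaryM (ulift x.2) x.1)).
have bF : bmeas F by exact: bmeas_comp (@measurable_unitaryZ_ulift n) bf.
transitivity (\int[mu]_V \int[mu1]_U F (U, V)).
  rewrite -[LHS](prob_int_cst mu); apply: eq_Rintegral => V _.
  by rewrite -(haar_int mu1P (ulift V) bfZ).
rewrite -prob_int_Fubini//; apply: eq_Rintegral => U _.
have [W WE] := charpoly_rec U.
pose g (V : borel_unitary R n) := f (corner U * unitaryZ V).
have bg : bmeas g.
  apply: (bmeas_comp _ bf); apply: measurable_funM => //.
  exact: measurable_unitaryZ.
rewrite -[RHS](haar_int muP W bg); apply: eq_Rintegral => V _.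
by rewrite /F /g /unitaryZ WE Normc.normcM.
Qed.

End charpoly_recursion.

(** * Characters of the half-line and their means *)

Section characters.
Variable R : realType.
Implicit Types t x y : R.

(* Real and imaginary part of x^(it), both set to 0 at x = 0. *)
Definition cosln t x := if x == 0 then 0 else cos (t * ln x).
Definition sinln t x := if x == 0 then 0 else sin (t * ln x).

(** The value 0 at 0 makes x^(it) multiplicative on all nonnegative reals, so a vanishing
    determinant needs no separate case. *)
Lemma coslnM t x y : 0 <= x -> 0 <= y ->
  cosln t (x * y) = cosln t x * cosln t y - sinln t x * sinln t y.
Proof.
rewrite !le_eqVlt /cosln /sinln.
move=> /predU1P[<-|x0]; first by rewrite eqxx !mul0r eqxx subrr.
move=> /predU1P[<-|y0]; first by rewrite eqxx !mulr0 eqxx subrr.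
rewrite mulf_eq0 !gt_eqF//= lnM ?posrE// mulrDr; exact: cosD.
Qed.

Lemma sinlnM t x y : 0 <= x -> 0 <= y ->
  sinln t (x * y) = sinln t x * cosln t y + cosln t x * sinln t y.
Proof.
rewrite !le_eqVlt /cosln /sinln.
move=> /predU1P[<-|x0]; first by rewrite eqxx !mul0r eqxx addr0.
move=> /predU1P[<-|y0]; first by rewrite eqxx !mulr0 eqxx addr0.
rewrite mulf_eq0 !gt_eqF//= lnM ?posrE// mulrDr; exact: sinD.
Qed.

Lemma measurable_if_eq0 (f : R -> R) : measurable_fun setT f ->
  measurable_fun setT (fun x => if x == 0 then 0 else f x).
Proof.
move=> mf; apply: measurable_fun_ifT => //.
exact: (measurable_fun_eqr (@measurable_id _ _ _) (@measurable_cst _ _ _ _ _ _)).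
Qed.

Lemma bmeas_cosln t : bmeas (cosln t).
Proof.
apply: (bmeas_bound (M := 1)) => [|x].
  apply: measurable_if_eq0.
  apply: (measurableT_comp (f := @cos R)).
    by apply: continuous_measurable_fun; exact: continuous_cos.
  by apply: measurable_funM => //; exact: measurable_ln.
rewrite /cosln; case: ifP => _; first by rewrite normr0.
by rewrite ler_norml cos_geN1 cos_le1.
Qed.

Lemma bmeas_sinln t : bmeas (sinln t).
Proof.
apply: (bmeas_bound (M := 1)) => [|x].
  apply: measurable_if_eq0.
  apply: (measurableT_comp (f := @sin R)).
    by apply: continuous_measurable_fun; exact: continuous_sin.
  by apply: measurable_funM => //; exact: measurable_ln.
rewrite /sinln; case: ifP => _; first by rewrite normr0.
by rewrite ler_norml sin_geN1 sin_le1.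
Qed.

Variable haar : forall N : nat, probability (borel_unitary R N) R.
Hypothesis haarP : forall N, is_haar (haar N).

(** [cosZ] and [sinZ] are the real and imaginary parts of E |Z_n|^(it); [cos_corner] and
    [sin_corner] are those of E |1 - a|^(it) for the corner entry a in U(n+1). *)
Definition cosZ t n := \int[haar n]_U cosln t (unitaryZ U).
Definition sinZ t n := \int[haar n]_U sinln t (unitaryZ U).
Definition cos_corner t n := \int[haar n.+1]_U cosln t (corner U).
Definition sin_corner t n := \int[haar n.+1]_U sinln t (corner U).

Let bcZ t n := bmeas_comp (@measurable_unitaryZ R n) (bmeas_cosln t).
Let bsZ t n := bmeas_comp (@measurable_unitaryZ R n) (bmeas_sinln t).
Let bcc t n := bmeas_comp (@measurable_corner R n) (bmeas_cosln t).
Let bsc t n := bmeas_comp (@measurable_corner R n) (bmeas_sinln t).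

Ltac bm := rewrite /=; first [exact: bcZ | exact: bsZ | exact: bcc | exact: bsc
  | apply: bmeasZ; bm].

Lemma cosZ_rec t n :
  cosZ t n.+1 = cos_corner t n * cosZ t n - sin_corner t n * sinZ t n.
Proof.
rewrite /cosZ (unitaryZ_int_rec (@haarP n.+1) (@haarP n) (bmeas_cosln t)).
under eq_Rintegral => U _.
  under eq_Rintegral do rewrite coslnM ?corner_ge0 ?unitaryZ_ge0//.
  rewrite prob_intB ?prob_intZ; [|bm..].
  over.
rewrite -/(cosZ t n) -/(sinZ t n).
under eq_Rintegral do rewrite mulrC [X in _ - X]mulrC.
by rewrite prob_intB ?prob_intZ; [rewrite mulrC [X in _ - X]mulrC|bm..].
Qed.

Lemma sinZ_rec t n :
  sinZ t n.+1 = sin_corner t n * cosZ t n + cos_corner t n * sinZ t n.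
Proof.
rewrite /sinZ (unitaryZ_int_rec (@haarP n.+1) (@haarP n) (bmeas_sinln t)).
under eq_Rintegral => U _.
  under eq_Rintegral do rewrite sinlnM ?corner_ge0 ?unitaryZ_ge0//.
  rewrite prob_intD ?prob_intZ; [|bm..].
  over.
rewrite -/(cosZ t n) -/(sinZ t n).
under eq_Rintegral do rewrite mulrC [X in _ + X]mulrC.
by rewrite prob_intD ?prob_intZ; [rewrite mulrC [X in _ + X]mulrC|bm..].
Qed.

(** The two recursions form a product of complex numbers, so squared moduli multiply. *)
Lemma charZ_rec t n : cosZ t n.+1 ^+ 2 + sinZ t n.+1 ^+ 2 =
  (cos_corner t n ^+ 2 + sin_corner t n ^+ 2) * (cosZ t n ^+ 2 + sinZ t n ^+ 2).
Proof. by rewrite cosZ_rec sinZ_rec; ring. Qed.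

End characters.

(** * Moments of a matrix entry *)

Lemma conj_RC (R : realType) (x : R) : Num.conj (x%:C)%C = (x%:C)%C.
Proof. exact: conjc_real. Qed.

Section special_unitaries.
Variables (R : realType) (n : nat).

Lemma uscal_subproof (z : R[i]) : Normc.normc z = 1 ->
  (z%:M : 'M[R[i]]_n) \is unitarymx.
Proof.
move=> z1; apply/unitarymxP; rewrite tr_scalar_mx map_scalar_mx -scalar_mxM /=.
by rewrite sqr_normC_real z1 expr1n.
Qed.

Definition uscal (z : R[i]) (z1 : Normc.normc z = 1) : unitary R n :=
  Unitary (uscal_subproof z1).

Lemma uscalE (z : R[i]) (z1 : Normc.normc z = 1) (U : unitary R n) i j :
  unitaryM (uscal z1) U i j = z * U i j.
Proof. by rewrite /= mul_scalar_mx mxE. Qed.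

Variables (i j : 'I_n) (m : R).
Hypothesis ij : i != j.

Let w : 'rV[R[i]]_n := delta_mx 0 i + (m%:C)%C *: delta_mx 0 j.
(** The Householder coefficient 2 / |w|^2. *)
Let c : R := 2 / (1 + m ^+ 2).

Let wc : map_mx Num.conj w = w.
Proof.
apply/matrixP => k l; rewrite !mxE rmorphD rmorphM /=.
by rewrite !rmorph_nat conj_RC.
Qed.

Let ww : w *m w^T = ((1 + m ^+ 2)%:C)%C%:M.
Proof.
have ji : j != i by rewrite eq_sym.
rewrite /w linearD linearZ /= !trmx_delta mulmxDl !mulmxDr.
rewrite -!scalemxAl -!scalemxAr !mul_delta_mx !mul_delta_mx_0//.
rewrite !scaler0 addr0 add0r scalerA.
apply/matrixP => k l; rewrite !ord1 !mxE !eqxx /= mulr1.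
by rewrite rmorphD /= rmorph1 mulr1n rmorphXn /= expr2.
Qed.

(* The reflection in the hyperplane orthogonal to [e_i + m e_j]. *)
Lemma reflection_subproof :
  (1%:M - (c%:C)%C *: (w^T *m w)) \is unitarymx.
Proof.
set K := w^T *m w.
have cm : c * (1 + m ^+ 2) = 2.
  by rewrite /c divfK// gt_eqF// ltr_pwDl// sqr_ge0.
have KT : K^t* = K by rewrite /K trmx_mul trmxK map_mxM /= -map_trmx wc.
have KK : K *m K = ((1 + m ^+ 2)%:C)%C *: K.
  by rewrite /K mulmxA -(mulmxA _ w) ww mul_mx_scalar scalemxAl.
apply/unitarymxP.
have -> : (1%:M - (c%:C)%C *: K)^t* = 1%:M - (c%:C)%C *: K.
  apply/matrixP => k l; rewrite !mxE rmorphB rmorphM /= rmorph_nat conj_RC.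
  have /matrixP/(_ k l) := KT; rewrite !mxE => ->.
  by rewrite eq_sym.
rewrite mulmxBl !mulmxBr !mul1mx !mulmx1.
rewrite -scalemxAl -scalemxAr KK !scalerA.
have -> : (c%:C * c%:C * (1 + m ^+ 2)%:C = c%:C + c%:C :> R[i])%C.
  by rewrite -!rmorphM -rmorphD /= -mulrA cm mulr_natr mulr2n.
by rewrite scalerDl opprB addrK subrK.
Qed.

Definition reflection : unitary R n := Unitary reflection_subproof.

(** The coefficients 1 - c = (m^2 - 1) / (m^2 + 1) and - c m are the coordinates of a rational point
    of the unit circle: (0, 1) for m = -1, (3/5, -4/5) for m = 2 and (3/5, 4/5) for m = -2. *)
Lemma reflectionE (U : unitary R n) (l : 'I_n) :
  complex.Re (unitaryM reflection U i l) =
  (1 - c) * complex.Re (U i l) - c * m * complex.Re (U j l).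
Proof.
have -> : unitaryM reflection U i l =
    U i l - (c%:C)%C * (U i l + (m%:C)%C * U j l).
  rewrite /= mulmxBl mul1mx -scalemxAl -mulmxA mulmxDl -scalemxAl -!rowE.
  rewrite 4!mxE big_ord1 !mxE !eqxx /= (negbTE ij) mulr0 addr0 mul1r.
  by [].
by rewrite Re_addc Re_oppc Re_mulc Re_addc Re_mulc /= !mul0r !subr0; ring.
Qed.

End special_unitaries.

Section entry_moments.
Variables (R : realType) (n : nat).
Variable mu : probability (borel_unitary R n.+1) R.
Hypothesis muP : is_haar mu.
Implicit Types (U : borel_unitary R n.+1) (i : 'I_n.+1).

Let re i U := complex.Re (U i ord0).
Let im i U := complex.Im (U i ord0).

Lemma Re_le_normc (z : R[i]) : `|complex.Re z| <= Normc.normc z.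
Proof.
rewrite -(@ler_pXn2r _ 2)// ?nnegrE ?normc_ge0//.
by rewrite real_normK ?num_real// sqr_normcE lerDl sqr_ge0.
Qed.

Lemma Im_le_normc (z : R[i]) : `|complex.Im z| <= Normc.normc z.
Proof.
rewrite -(@ler_pXn2r _ 2)// ?nnegrE ?normc_ge0//.
by rewrite real_normK ?num_real// sqr_normcE lerDr sqr_ge0.
Qed.

Lemma bmeas_re i : bmeas (re i).
Proof.
have [mR _] := cmeas_entry R i ord0; apply: (bmeas_bound (M := 1)) => // U.
exact: le_trans (Re_le_normc _) (unitary_entry_le1 _ _ _).
Qed.

Lemma bmeas_im i : bmeas (im i).
Proof.
have [_ mI] := cmeas_entry R i ord0; apply: (bmeas_bound (M := 1)) => // U.
exact: le_trans (Im_le_normc _) (unitary_entry_le1 _ _ _).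
Qed.

Lemma int_re_swap i p : \int[mu]_U (re i U ^+ p) = \int[mu]_U (re ord0 U ^+ p).
Proof.
have [->//|i0] := eqVneq i ord0; rewrite eq_sym in i0.
(* For m = -1 the reflection exchanges rows 0 and i. *)
rewrite -(haar_int muP (reflection (-1) i0) (bmeasX p (bmeas_re ord0))).
apply: eq_Rintegral => U _; congr (_ ^+ _).
by rewrite /re reflectionE; field.
Qed.

(** Multiplication by the scalar i turns the real part into minus the imaginary part. *)
Lemma int_im_sqr i : \int[mu]_U (im i U ^+ 2) = \int[mu]_U (re i U ^+ 2).
Proof.
have i1 : Normc.normc ('i%C : R[i]) = 1.
  by rewrite /= expr0n expr1n add0r sqrtr1.
rewrite -(haar_int muP (uscal _ i1) (bmeasX 2 (bmeas_re i))).
apply: eq_Rintegral => U _.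
by rewrite /re uscalE Re_mulc /= mul0r mul1r sub0r sqrrN.
Qed.

(** A column has norm 1, and its 2 (n + 1) real coordinates share the same second moment. *)
Lemma entry_second_moment : \int[mu]_U (re ord0 U ^+ 2) = (2 * n.+1%:R)^-1.
Proof.
set E2 := \int[mu]_U _.
have b1 i : bmeas (fun U => re i U ^+ 2 + im i U ^+ 2).
  by apply: bmeasD; apply: bmeasX; [exact: bmeas_re|exact: bmeas_im].
have : \int[mu]_U (\sum_i (re i U ^+ 2 + im i U ^+ 2)) = 1.
  rewrite -[RHS](prob_int_cst mu); apply: eq_Rintegral => U _.
  rewrite -[RHS](unitary_col_norm U ord0); apply: eq_bigr => i _.
  by rewrite sqr_normcE.
rewrite prob_int_sum//.
under eq_bigr => i _.
  rewrite prob_intD; [|exact/bmeasX/bmeas_re|exact/bmeasX/bmeas_im].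
  rewrite int_im_sqr int_re_swap -/E2; over.
rewrite sumr_const card_ord => E.
have n2 : 2 * n.+1%:R != 0 :> R by rewrite mulf_neq0 ?pnatr_eq0.
have E1 : E2 * (2 * n.+1%:R) = 1.
  by rewrite -[RHS]E -[RHS]mulr_natr; ring.
by rewrite -[LHS](mulfK n2) E1 mul1r.
Qed.

(* The invariance of E x^4 under the rotation x |-> (3 x +- 4 y) / 5
   determines the mixed moment E x^2 y^2. *)
Lemma int_re_mixed i : i != ord0 ->
  \int[mu]_U (re ord0 U ^+ 4) = 3 * \int[mu]_U (re ord0 U ^+ 2 * re i U ^+ 2).
Proof.
rewrite eq_sym => i0; set E4 := LHS.
have b4 := bmeasX 4 (bmeas_re ord0).
have b4i := bmeasX 4 (bmeas_re i).
have b22 := bmeasM (bmeasX 2 (bmeas_re ord0)) (bmeasX 2 (bmeas_re i)).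
set E22 := \int[mu]_U (_ * _).
have Ei : \int[mu]_U (re i U ^+ 4) = E4 by exact: int_re_swap.
pose x := re ord0; pose y := re i.
have e1 : E4 = \int[mu]_U ((3 / 5 * x U - 4 / 5 * y U) ^+ 4).
  rewrite /E4 -(haar_int muP (reflection 2 i0) b4); apply: eq_Rintegral => U _.
  by congr (_ ^+ _); rewrite /re reflectionE /x /y /re; field.
have e2 : E4 = \int[mu]_U ((3 / 5 * x U + 4 / 5 * y U) ^+ 4).
  rewrite /E4 -(haar_int muP (reflection (-2) i0) b4); apply: eq_Rintegral => U _.
  by congr (_ ^+ _); rewrite /re reflectionE /x /y /re; field.
have bx := bmeasZ (3 / 5) (bmeas_re ord0).
have by_ := bmeasZ (4 / 5) (bmeas_re i).
(* Adding the two expansions cancels the terms odd in [y]; the coefficients are 2 3^4, 2 4^4 and 12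
   3^2 4^2 over 5^4. *)
have : E4 + E4 = \int[mu]_U ((162 / 625 * x U ^+ 4 + 512 / 625 * y U ^+ 4) +
    1728 / 625 * (x U ^+ 2 * y U ^+ 2)).
  rewrite {1}e1 {1}e2 -prob_intD; last 2 first.
  - by apply: bmeasX; exact: bmeasB.
  - by apply: bmeasX; exact: bmeasD.
  by apply: eq_Rintegral => U _; field.
have b1 := bmeasZ (162 / 625) b4; have b2 := bmeasZ (512 / 625) b4i.
have b3 := bmeasZ (1728 / 625) b22.
rewrite prob_intD ?prob_intD ?prob_intZ//; last exact: bmeasD.
by rewrite Ei -/E4 -/E22 => h; lra.
Qed.

(** Multiply x^2 by the sum of the squared real parts down the column, which is at most 1, and
    integrate: each of the n mixed moments is a third of E x^4, so E x^4 + n E x^4 / 3 <= E x^2. *)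
Lemma entry_fourth_moment :
  (n%:R + 3) * \int[mu]_U (re ord0 U ^+ 4) <= 3 * \int[mu]_U (re ord0 U ^+ 2).
Proof.
set E4 := \int[mu]_U _; set E2 := \int[mu]_U _.
have b0 := bmeasX 2 (bmeas_re ord0).
have b22 i := bmeasM b0 (bmeasX 2 (bmeas_re i)).
have : \sum_i \int[mu]_U (re ord0 U ^+ 2 * re i U ^+ 2) <= E2.
  rewrite -prob_int_sum//; apply: prob_int_le => // [|U]; first exact: bmeas_sum.
  rewrite -mulr_sumr -[leRHS]mulr1 ler_wpM2l ?sqr_ge0//.
  rewrite -(unitary_col_norm U ord0); apply: ler_sum => i _.
  by rewrite sqr_normcE lerDl sqr_ge0.
rewrite (bigD1 ord0)//=.
rewrite (_ : \int[mu]_U (re ord0 U ^+ 2 * re ord0 U ^+ 2) = E4); last first.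
  by apply: eq_Rintegral => U _; rewrite -exprD.
rewrite (eq_bigr (fun=> E4 / 3)); last first.
  by move=> i i0; rewrite /E4 (int_re_mixed i0) mulrC mulKf// pnatr_eq0.
rewrite sumr_const.
rewrite (_ : #|[pred i | i != ord0]| = n); last by rewrite cardC1 card_ord.
by rewrite -mulr_natr => h; lra.
Qed.

End entry_moments.

(** * Decay of the characteristic functions *)

Section pointwise_bound.
Variable R : realType.
Implicit Types t u v x y : R.

(** By the mean value theorem sin y = y cos c with c <= 1, and cosine decreases on [0, 1]. *)
Lemma sin_ge_lin y : 0 <= y <= 1 -> y * cos 1 <= sin y.
Proof.
move=> /andP[y0 y1].
have [c] := @MVT_segment R sin cos 0 y y0 (fun x _ => is_derive_sin x)
  (continuous_subspaceT (@continuous_sin R)).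
rewrite in_itv /= => /andP[c0 cy]; rewrite sin0 !subr0 => ->.
rewrite mulrC ler_wpM2r//.
have p2 := @pi_ge2 R.
have [->//|c1] := eqVneq c 1.
apply/ltW; rewrite ltr_cos ?in_itv /=.
- by rewrite lt_neqAle c1 (le_trans cy).
- by rewrite c0 (le_trans cy)// (le_trans y1)//; lra.
- by rewrite ler01 /=; lra.
Qed.

Lemma char_sqr_le1 t u : cosln t u ^+ 2 + sinln t u ^+ 2 <= 1.
Proof.
rewrite /cosln /sinln; case: ifP => _; last by rewrite cos2Dsin2.
by rewrite expr0n addr0 ler01.
Qed.

(** The squared modulus of the mean of u^(it) and v^(it). *)
Definition pair_sqr t u v :=
  ((cosln t u + cosln t v) / 2) ^+ 2 + ((sinln t u + sinln t v) / 2) ^+ 2.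

Lemma pair_sqrC t u v : pair_sqr t u v = pair_sqr t v u.
Proof. by rewrite /pair_sqr; ring. Qed.

Lemma pair_sqr_le1 t u v : pair_sqr t u v <= 1.
Proof.
rewrite /pair_sqr; have := char_sqr_le1 t u; have := char_sqr_le1 t v.
move: (cosln t u) (cosln t v) (sinln t u) (sinln t v) => a b c e h1 h2.
have := sqr_ge0 (a - b); have := sqr_ge0 (c - e); nra.
Qed.

(** The mean of two unit complex numbers has modulus |cos p|, with [p] half the difference of their
    angles. *)
Lemma pair_sqrE t u v : 0 < u -> 0 < v ->
  pair_sqr t u v = 1 - sin (t / 2 * (ln v - ln u)) ^+ 2.
Proof.
move=> u0 v0; rewrite /pair_sqr /cosln /sinln !gt_eqF//.
set p := t / 2 * (ln v - ln u); set q := t / 2 * (ln v + ln u).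
have -> : t * ln u = q - p by rewrite /p /q; field.
have -> : t * ln v = q + p by rewrite /p /q; field.
rewrite cosB cosD sinB sinD -cos2sin2.
transitivity (cos p ^+ 2 * (cos q ^+ 2 + sin q ^+ 2)); first by field.
by rewrite cos2Dsin2 mulr1.
Qed.

Lemma ln_le_sub1 x : 0 < x -> ln x <= x - 1.
Proof.
move=> x0; rewrite -[X in ln X](subrKC 1 x).
by apply: le_ln1Dx; lra.
Qed.

(* [A] stands for [1 + |a|^2] and [x] for [Re a], so that [u = |1 - a|] and
   [v = |1 + a|]. *)
Lemma ln_ratio_bounds A u v x : 1 <= A <= 2 -> 0 < u -> 0 < v ->
  u ^+ 2 = A - 2 * x -> v ^+ 2 = A + 2 * x -> 0 <= x <= 4^-1 ->
  x / 2 <= ln v - ln u <= 4 * x.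
Proof.
move=> /andP[A1 A2] u0 v0 uE vE /andP[x0 x4].
have u20 : 0 < u ^+ 2 by rewrite exprn_gt0.
have v20 : 0 < v ^+ 2 by rewrite exprn_gt0.
have h1 := ln_le_sub1 (divr_gt0 u20 v20).
have h2 := ln_le_sub1 (divr_gt0 v20 u20).
rewrite !ln_div ?posrE// !lnXn// !mulr2n in h1 h2.
(* The left sides of [k1] and [k2] are -4x / (A + 2x) and 4x / (A - 2x), where A + 2x <= 4 and A -
   2x >= 1/2; logarithms of squares halve the bounds. *)
have k1 : u ^+ 2 / v ^+ 2 - 1 <= - x.
  rewrite lerBlDr ler_pdivrMr//; rewrite uE vE; nra.
have k2 : v ^+ 2 / u ^+ 2 - 1 <= 8 * x.
  rewrite lerBlDr ler_pdivrMr//; rewrite uE vE; nra.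
by apply/andP; split; lra.
Qed.

Lemma pair_sqr_bound_small t A u v x : t != 0 -> 1 <= A <= 2 ->
  0 < u -> 0 < v -> u ^+ 2 = A - 2 * x -> v ^+ 2 = A + 2 * x ->
  0 <= x <= 4^-1 -> x <= (2 * `|t|)^-1 ->
  pair_sqr t u v <= 1 - (`|t| * cos 1 / 4) ^+ 2 * x ^+ 2.
Proof.
move=> t0 A12 u0 v0 uE vE x4 xt.
have /andP[l1 l2] := ln_ratio_bounds A12 u0 v0 uE vE x4.
have /andP[x0 _] := x4.
have nt : 0 < `|t| by rewrite normr_gt0.
rewrite pair_sqrE//; set l := ln v - ln u in l1 l2 *.
have -> : sin (t / 2 * l) ^+ 2 = sin (`|t| / 2 * l) ^+ 2.
  case: (lerP 0 t) => [/ger0_norm->//|/ltr0_norm->].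
  by rewrite !mulNr sinN sqrrN.
have tx : `|t| * x <= 2^-1.
  by move: xt; rewrite invfM -[_ * `|t|^-1]/(_ / _) ler_pdivlMr// mulrC.
(* As l <= 4x, the angle is at most 2 |t| x <= 1, the range of the linear bound on the sine. *)
have y1 : 0 <= `|t| / 2 * l <= 1 by apply/andP; split; nra.
have := sin_ge_lin y1; set y := `|t| / 2 * l => hs.
have c1 := @cos1_gt0 R.
have hy : `|t| / 4 * x <= y by rewrite /y; nra.
have : `|t| * cos 1 / 4 * x <= sin y.
  apply: le_trans hs; have := ler_wpM2r (ltW c1) hy; lra.
rewrite lerD2l lerN2 -exprMn => h.
have p0 : 0 <= `|t| * cos 1 / 4 * x.
  by rewrite mulr_ge0// divr_ge0// mulr_ge0// ltW.
by rewrite lerXn2r ?nnegrE// (le_trans p0).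
Qed.

(** The quartic correction makes the bound uniform in a: for |Re a| <= d the sine estimate applies,
    and beyond d the bracket is at most 0, so that [pair_sqr_le1] suffices. *)
Lemma pair_sqr_bound t : t != 0 -> exists kd : R * R,
  [/\ 0 < kd.1, 0 < kd.2 & forall a : R[i], Normc.normc a <= 1 ->
    pair_sqr t (Normc.normc (1 - a)) (Normc.normc (1 + a)) <=
    1 - kd.1 * (complex.Re a ^+ 2 - complex.Re a ^+ 4 / kd.2 ^+ 2)].
Proof.
move=> t0; have nt : 0 < `|t| by rewrite normr_gt0.
pose k := (`|t| * cos 1 / 4) ^+ 2; pose d := Num.min 4^-1 (2 * `|t|)^-1.
have k0 : 0 < k by rewrite exprn_gt0// divr_gt0// mulr_gt0// cos1_gt0.
have d0 : 0 < d by rewrite lt_min !invr_gt0 mulr_gt0// andbT.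
exists (k, d); split => //= a a1.
set x := complex.Re a.
pose A := 1 + Normc.normc a ^+ 2.
have A12 : 1 <= A <= 2.
  have := normc_ge0 a; rewrite /A => h; apply/andP; split; nra.
have uE : Normc.normc (1 - a) ^+ 2 = A - 2 * x.
  by rewrite /A !sqr_normcE Re_addc Im_addc Re_oppc Im_oppc /= /x; ring.
have vE : Normc.normc (1 + a) ^+ 2 = A + 2 * x.
  by rewrite /A !sqr_normcE Re_addc Im_addc /= /x; ring.
have [xd|dx] := leP `|x| d; last first.
  apply: le_trans (pair_sqr_le1 _ _ _) _.
  rewrite lerDl oppr_ge0 mulr_ge0_le0 ?(ltW k0)// subr_le0.
  rewrite ler_pdivlMr ?exprn_gt0// (exprD x 2 2) ler_wpM2l ?sqr_ge0//.
  by rewrite -[leRHS]real_normK ?num_real// lerXn2r ?nnegrE// ltW.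
apply: (@le_trans _ _ (1 - k * x ^+ 2)); last first.
  rewrite lerD2l lerN2 ler_wpM2l ?(ltW k0)// gerBl divr_ge0//.
    by rewrite (exprM x 2 2) sqr_ge0.
  exact: sqr_ge0.
have /andP[xd1 xd2] : (`|x| <= 4^-1) && (`|x| <= (2 * `|t|)^-1).
  by rewrite -le_min.
have u0 : 0 < Normc.normc (1 - a).
  rewrite lt_neqAle normc_ge0 andbT eq_sym -sqrf_eq0 uE gt_eqF//.
  have := ler_norm x; have /andP[] := A12; lra.
have v0 : 0 < Normc.normc (1 + a).
  rewrite lt_neqAle normc_ge0 andbT eq_sym -sqrf_eq0 vE gt_eqF//.
  have := ler_norm (- x); rewrite normrN; have /andP[] := A12; lra.
have [x0|x0] := lerP 0 x.
  rewrite (ger0_norm x0) in xd1 xd2.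
  by apply: pair_sqr_bound_small A12 u0 v0 uE vE _ xd2 => //; rewrite x0.
rewrite (ltr0_norm x0) in xd1 xd2.
(* For a negative real part, exchange a and -a. *)
rewrite pair_sqrC -[x ^+ 2]sqrrN.
apply: pair_sqr_bound_small A12 v0 u0 _ _ _ xd2 => //.
- by rewrite vE; ring.
- by rewrite uE; ring.
- by rewrite oppr_ge0 (ltW x0).
Qed.

End pointwise_bound.

(** A limit L > 0 would force a drop of at least k L / (n + 1) at each late step; telescoping would
    then bound the harmonic series. *)
Lemma harmonic_decay (R : realType) (rho : nat -> R) (k : R) (n0 : nat) :
  0 < k -> (forall n, 0 <= rho n) -> (forall n, rho n.+1 <= rho n) ->
  (forall n, (n0 <= n)%N -> rho n.+1 <= (1 - k / n.+1%:R) * rho n) ->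
  rho @ \oo --> 0.
Proof.
move=> k0 rho0 rhoS rhok.
have dec : nonincreasing_seq rho by apply/nonincreasing_seqP.
have crho : cvgn rho.
  by apply: nonincreasing_is_cvgn => //; exists 0 => _ [n _ <-].
set L := limn rho; have Lle := nonincreasing_cvgn_ge dec crho.
have [L0|L0] := leP L 0.
  suff -> : 0 = L by [].
  apply/eqP; rewrite eq_le L0 andbT.
  by apply: limr_ge => //; exact: nearW.
exfalso; apply: (@dvg_harmonic R).
pose H := series (@harmonic R).
have kL : 0 < k * L by rewrite mulr_gt0.
have key m : H (n0 + m)%N * (k * L) <= H n0 * (k * L) + rho n0 - rho (n0 + m)%N.
  elim: m => [|m IH]; first by rewrite addn0 addrK.
  have := rhok (n0 + m)%N (leq_addr _ _); rewrite addnS.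
  have HS : H (n0 + m).+1 = H (n0 + m)%N + (n0 + m).+1%:R^-1.
    by rewrite /H /series /= big_nat_recr.
  rewrite HS; move: (Lle (n0 + m)%N) IH; rewrite -/L.
  set r := rho (n0 + m)%N; set r' := rho _; set q := (n0 + m).+1%:R^-1 : R.
  have q0 : 0 < q by rewrite invr_gt0.
  move=> Lr IH hr.
  have : q * (k * L) <= q * (k * r) by rewrite ler_wpM2l ?ler_wpM2l// ltW.
  by move: hr IH; rewrite -/q !mulrDl mul1r mulNr; lra.
have Hnd : nondecreasing_seq H.
  apply/nondecreasing_seqP => m.
  by rewrite /H /series /= big_nat_recr//= lerDl invr_ge0.
apply: nondecreasing_is_cvgn => //.
exists (H n0 + rho n0 / (k * L)) => _ [n _ <-].
apply: le_trans (Hnd _ _ (leq_addl n0 n)) _.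
rewrite -(ler_pM2r kL) mulrDl divfK ?gt_eqF//.
by apply: le_trans (key n) _; rewrite gerBl.
Qed.

(** * Characteristic function of one corner factor *)

Section corner_decay.
Variable R : realType.
Variables (n : nat) (mu : probability (borel_unitary R n.+1) R).
Hypothesis muP : is_haar mu.

Lemma int_corner_opp (f : R -> R) : bmeas f ->
  \int[mu]_U f (corner U) = \int[mu]_U f (Normc.normc (1 + U ord0 ord0)).
Proof.
move=> bf; have N1 : Normc.normc (-1 : R[i]) = 1 by rewrite normcN Normc.normc1.
rewrite -(haar_int muP (uscal _ N1) (bmeas_comp (@measurable_corner R n) bf)).
apply: eq_Rintegral => U _; congr (f (Normc.normc _)).
by rewrite uscalE mulN1r opprK.
Qed.

Lemma bmeas_corner_opp (f : R -> R) : bmeas f ->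
  bmeas (fun U : borel_unitary R n.+1 => f (Normc.normc (1 + U ord0 ord0))).
Proof.
apply: bmeas_comp; apply: measurable_normc.
by apply: cmeasD; [exact: cmeas_cst|exact: cmeas_entry].
Qed.

(** This uses that a and -a have the same law; the squares of the averaged cosine and sine are the
    two terms of [pair_sqr]. *)
Lemma int_corner_avg (f : R -> R) : bmeas f -> \int[mu]_U f (corner U) =
  \int[mu]_U ((f (corner U) + f (Normc.normc (1 + U ord0 ord0))) / 2).
Proof.
move=> bf.
have b1 := bmeas_comp (@measurable_corner R n) bf.
have b2 := bmeas_corner_opp bf.
under [RHS]eq_Rintegral do rewrite mulrC.
rewrite prob_intZ; last exact: bmeasD.
by rewrite prob_intD// -int_corner_opp//; field.
Qed.

Lemma corner_char_bound (t k d : R) : 0 < k -> 0 < d ->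
  (forall a : R[i], Normc.normc a <= 1 ->
    pair_sqr t (Normc.normc (1 - a)) (Normc.normc (1 + a)) <=
    1 - k * (complex.Re a ^+ 2 - complex.Re a ^+ 4 / d ^+ 2)) ->
  6 / d ^+ 2 <= n%:R ->
  (\int[mu]_U cosln t (corner U)) ^+ 2 + (\int[mu]_U sinln t (corner U)) ^+ 2
    <= 1 - (k / 4) / n.+1%:R.
Proof.
move=> k0 d0 bound nd.
have bavg (f : R -> R) : bmeas f -> bmeas (fun U : borel_unitary R n.+1 =>
    (f (corner U) + f (Normc.normc (1 + U ord0 ord0))) / 2).
  move=> bf.
  have h := bmeasD (bmeas_comp (@measurable_corner R n) bf) (bmeas_corner_opp bf).
  exact: (bmeasM h (bmeas_cst _ 2^-1)).
have bC := bavg _ (bmeas_cosln t); have bS := bavg _ (bmeas_sinln t).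
rewrite (int_corner_avg (bmeas_cosln t)) (int_corner_avg (bmeas_sinln t)).
(* Nonnegativity of the variance moves the squares under the integral, where they sum to
   [pair_sqr]. *)
apply: le_trans (lerD (prob_int_sqr mu bC) (prob_int_sqr mu bS)) _.
rewrite -prob_intD; [|exact: bmeasX..].
set x := fun U : borel_unitary R n.+1 => complex.Re (U ord0 ord0).
have bx : bmeas x by exact: bmeas_re.
have b2 : bmeas (fun U => k * (x U ^+ 2)) by exact/bmeasZ/bmeasX.
have b4 : bmeas (fun U => k / d ^+ 2 * (x U ^+ 4)) by exact/bmeasZ/bmeasX.
apply: (@le_trans _ _
    (\int[mu]_U ((1 - k * (x U ^+ 2)) + k / d ^+ 2 * (x U ^+ 4)))).
  apply: prob_int_le.
  - by apply: bmeasD; exact: bmeasX.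
  - by apply: bmeasD => //; apply: bmeasB => //; exact: bmeas_cst.
  - move=> U; apply: le_trans (bound _ (unitary_entry_le1 U ord0 ord0)) _.
    by rewrite -/(x U) le_eqVlt; apply/orP; left; apply/eqP; field; rewrite gt_eqF.
have bB := bmeasB (bmeas_cst _ 1) b2.
rewrite prob_intD// prob_intB//; last exact: bmeas_cst.
rewrite prob_int_cst !prob_intZ; [|exact: bmeasX..].
have m2 := entry_second_moment muP; have m4 := entry_fourth_moment muP.
rewrite -/x in m2 m4; set E4 := \int[mu]_U _ in m4 *.
rewrite m2 in m4 *.
have d20 : 0 < d ^+ 2 by rewrite exprn_gt0.
have E40 : 0 <= E4.
  by apply: Rintegral_ge0 => U _; rewrite (exprM _ 2 2) sqr_ge0.
(* As 6 / d^2 <= n, the fourth-moment bound makes the quartic term at most half of the quadratic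
   one, which leaves k / 4 out of k / 2. *)
have hE : 2 * E4 / d ^+ 2 <= (2 * n.+1%:R)^-1.
  rewrite -(@ler_pM2l _ 3)//; apply: le_trans m4.
  rewrite (_ : 3 * (2 * E4 / d ^+ 2) = 6 / d ^+ 2 * E4); last by ring.
  by apply: ler_wpM2r => //; apply: le_trans nd _; rewrite lerDl.
have := ler_wpM2l (ltW k0) hE.
rewrite (invfM 2 n.+1%:R); set q := n.+1%:R^-1.
rewrite (_ : k * (2 * E4 / d ^+ 2) = 2 * (k / d ^+ 2 * E4)); last by ring.
set w := k / d ^+ 2 * E4; lra.
Qed.

End corner_decay.

Section char_decay.
Variable R : realType.
Variable haar : forall N : nat, probability (borel_unitary R N) R.
Hypothesis haarP : forall N, is_haar (haar N).

Lemma charZ_cvg0 (t : R) : t != 0 ->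
  cosZ haar t n ^+ 2 + sinZ haar t n ^+ 2 @[n --> \oo] --> 0.
Proof.
move=> t0; have [[k d] /= [k0 d0 bound]] := pair_sqr_bound t0.
(* From this index on n >= 6 / d^2, as [corner_char_bound] requires. *)
pose n0 := `|Num.ceil (6 / d ^+ 2)|%N.
have bc n := bmeas_comp (@measurable_corner R n) (bmeas_cosln t).
have bs n := bmeas_comp (@measurable_corner R n) (bmeas_sinln t).
apply: (@harmonic_decay _ _ (k / 4) n0); first by rewrite divr_gt0.
- by move=> n; rewrite addr_ge0// sqr_ge0.
- move=> n; rewrite charZ_rec// ler_piMl ?addr_ge0 ?sqr_ge0//.
  apply: le_trans (lerD (prob_int_sqr (haar n.+1) (bc n))
    (prob_int_sqr (haar n.+1) (bs n))) _.
  rewrite -prob_intD; [|exact/bmeasX/bc|exact/bmeasX/bs].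
  rewrite -[leRHS](prob_int_cst (haar n.+1)); apply: prob_int_le.
  + by apply: bmeasD; apply: bmeasX; [exact: bc|exact: bs].
  + exact: bmeas_cst.
  + by move=> U; exact: char_sqr_le1.
- move=> n n0n; rewrite charZ_rec// ler_wpM2r ?addr_ge0 ?sqr_ge0//.
  apply: (corner_char_bound (@haarP n.+1) k0 d0 bound).
  apply: le_trans (_ : n0%:R <= _); last by rewrite ler_nat.
  apply: le_trans (ceil_ge _) _.
  by rewrite /n0 natr_absz ler_int ler_norm.
Qed.

End char_decay.

(** * Almost sure nonvanishing *)

Section nonvanishing.
Variable R : realType.

Section entry_null.
Variables (n : nat) (mu : probability (borel_unitary R n.+1) R).
Hypothesis muP : is_haar mu.

(** Infinitely many points of the unit circle, with angles in (0, 1], where cosine is injective. *)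
Let expi (k : nat) : R[i] := (cos k.+1%:R^-1 +i* sin k.+1%:R^-1)%C.

Let expi1 k : Normc.normc (expi k) = 1.
Proof. by rewrite /= cos2Dsin2 sqrtr1. Qed.

Let expi_inj : injective expi.
Proof.
move=> k l [/cos_inj h _]; have p2 := @pi_ge2 R.
have kl0 (m : nat) : (m.+1%:R^-1 : R) \in `[0, pi].
  rewrite in_itv /= invr_ge0 ler0n /=.
  apply: le_trans (_ : 1 <= _); last by lra.
  by rewrite invf_le1// ler1n.
have /invr_inj/eqP := h (kl0 k) (kl0 l).
by rewrite eqr_nat eqSS => /eqP.
Qed.

Let f (a : R[i]) : R := (a == 1)%:R.

Let bmeas_f (z : R[i]) : bmeas (fun U : borel_unitary R n.+1 => f (z * U ord0 ord0)).
Proof.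
apply: (bmeas_bound (M := 1)) => [|U]; last first.
  by rewrite /f; case: (_ == _); rewrite ?normr1// normr0.
have mN : measurable_fun setT
    (fun U : borel_unitary R n.+1 => Normc.normc (z * U ord0 ord0 - 1)).
  apply: measurable_normc; apply: cmeasD; last exact: cmeas_cst.
  by apply: cmeasM; [exact: cmeas_cst|exact: cmeas_entry].
rewrite (_ : (fun U => _) = (fun U : borel_unitary R n.+1 =>
    if Normc.normc (z * U ord0 ord0 - 1) == 0 then 1 else 0)).
  apply: measurable_fun_ifT => //.
  have h0 := @measurable_cst _ _ (borel_unitary R n.+1) R setT 0.
  exact: (measurable_fun_eqr mN h0).
apply/funext => U; rewrite /f -subr_eq0.
case: eqVneq => [->|h]; first by rewrite Normc.normc0 eqxx.
by case: eqP => // /Normc.eq0_normc /eqP; rewrite (negbTE h).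
Qed.

(* The entry takes each value [1 / expi k] with the same probability. *)
Lemma int_entry_eq1 : \int[mu]_U f (U ord0 ord0) = 0.
Proof.
have bf : bmeas (fun U : borel_unitary R n.+1 => f (U ord0 ord0)).
  by have := bmeas_f 1; under [fun U => _]funext do rewrite mul1r.
set p := LHS; have pE k : \int[mu]_U f (expi k * U ord0 ord0) = p.
  rewrite /p -(haar_int muP (uscal _ (expi1 k)) bf).
  by apply: eq_Rintegral => U _; rewrite uscalE.
have p0 : 0 <= p by apply: Rintegral_ge0 => U _; exact: ler0n.
(* The events that [expi k] times the entry is 1, for k < m, are disjoint and all have probability
   [p]; a choice of m > 1 / p later excludes p > 0. *)
have pm (m : nat) : p *+ m <= 1.
  rewrite -[leRHS](prob_int_cst mu) -{1}(card_ord m) -sumr_const.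
  rewrite -(eq_bigr _ (fun (k : 'I_m) _ => pE k)) -prob_int_sum; last first.
    by move=> k; exact: bmeas_f.
  apply: prob_int_le; [by apply: bmeas_sum => k; exact: bmeas_f|exact: bmeas_cst|].
  move=> U; have [[k /eqP kE]|h] := pselect (exists k : 'I_m, expi k * U ord0 ord0 == 1).
    rewrite (bigD1 k)//= /f kE eqxx big1 ?addr0// => l lk.
    case: eqP => //= lE; exfalso; move/eqP: lk; apply.
    apply: val_inj; apply: expi_inj.
    have a0 : U ord0 ord0 != 0.
      by apply/eqP => a0; move/eqP: kE; rewrite a0 mulr0 eq_sym oner_eq0.
    by apply: (mulIf a0); rewrite lE kE.
  rewrite big1 ?ler01// => k _; rewrite /f; case: eqP => //= kE.
  by exfalso; apply: h; exists k; rewrite kE.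
apply/eqP; rewrite eq_le p0 andbT leNgt; apply/negP => pgt0.
have := pm (Num.bound p^-1); rewrite leNgt -mulr_natr.
rewrite -ltr_pdivrMl// mulr1.
by rewrite archi_boundP// invr_ge0.
Qed.

(** [cosln 0] is the indicator of the nonzero reals, so this says that the corner entry is almost
    surely different from 1. *)
Lemma cos_corner0 : \int[mu]_U cosln 0 (corner U) = 1.
Proof.
have bf : bmeas (fun U : borel_unitary R n.+1 => f (U ord0 ord0)).
  by have := bmeas_f 1; under [fun U => _]funext do rewrite mul1r.
transitivity (\int[mu]_U (1 - f (U ord0 ord0))).
  apply: eq_Rintegral => U _; rewrite /cosln /corner mul0r cos0 /f.
  case: (eqVneq (U ord0 ord0) 1) => [->|h].
    by rewrite subrr Normc.normc0 eqxx subrr.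
  case: eqP => [/Normc.eq0_normc /eqP|_]; last by rewrite subr0.
  by rewrite subr_eq0 eq_sym (negbTE h).
by rewrite prob_intB ?prob_int_cst ?int_entry_eq1 ?subr0//; exact: bmeas_cst.
Qed.

End entry_null.

Lemma sinln0 (x : R) : sinln 0 x = 0.
Proof. by rewrite /sinln mul0r sin0 if_same. Qed.

Variable haar : forall N : nat, probability (borel_unitary R N) R.
Hypothesis haarP : forall N, is_haar (haar N).

(** Likewise Z_n is almost surely nonzero: in law it is a product of almost surely nonzero
    factors. *)
Lemma cosZ0 n : cosZ haar 0 n = 1.
Proof.
elim: n => [|n IH].
  rewrite /cosZ -[RHS](prob_int_cst (haar 0%N)); apply: eq_Rintegral => U _.
  by rewrite /cosln /unitaryZ det_mx00 Normc.normc1 oner_eq0 mul0r cos0.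
rewrite cosZ_rec// IH mulr1 /cos_corner cos_corner0; last exact: haarP.
rewrite (_ : sin_corner haar 0 n = 0) ?mul0r ?subr0//.
rewrite -[RHS](prob_int_cst (haar n.+1)); apply: eq_Rintegral => U _.
by rewrite sinln0.
Qed.

End nonvanishing.

(** * Equidistribution *)

Section step_polynomial.
Variable R : realType.

Lemma expr1B_ge (z : R) (k : nat) : 0 <= z <= 1 -> 1 - k%:R * z <= (1 - z) ^+ k.
Proof.
move=> /andP[z0 z1]; elim: k => [|k IH]; first by rewrite mul0r subr0 expr0.
rewrite exprS -natr1; have := ler_wpM2l (_ : 0 <= 1 - z) IH.
have k0 : 0 <= k%:R :> R by [].
move=> h; apply: le_trans (h _); last by rewrite subr_ge0.
by nra.
Qed.

(** Induction from (1 - z) (1 + (k + 1) z) <= 1 + k z; this upper bound complements Bernoulli's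
    inequality above. *)
Lemma expr1B_le (z : R) (k : nat) : 0 <= z <= 1 ->
  (1 - z) ^+ k * (1 + k%:R * z) <= 1.
Proof.
move=> /andP[z0 z1]; elim: k => [|k IH]; first by rewrite mul0r addr0 expr0 mul1r.
apply: le_trans IH; rewrite exprSr -mulrA -natr1 ler_wpM2l//.
  by rewrite exprn_ge0// subr_ge0.
have k0 : 0 <= k%:R :> R by [].
by nra.
Qed.

(** The affine map x = 1/2 - (c - tau) / 4 sends [-1, 1] into [0, 1] and the threshold [tau] to 1/2,
    where (1 - x^m)^(2^m) jumps. *)
Definition step_poly (tau : R) (m : nat) : {poly R} :=
  (1 - ((2^-1 + tau / 4)%:P - (4^-1) *: 'X) ^+ m) ^+ (2 ^ m).

Lemma step_polyE tau m c :
  (step_poly tau m).[c] = (1 - (2^-1 - (c - tau) / 4) ^+ m) ^+ (2 ^ m).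
Proof.
rewrite /step_poly !(hornerE, horner_exp).
by congr ((1 - _ ^+ _) ^+ _); field.
Qed.

(* For [x] in [0, 1] the values [(1 - x^m)^(2^m)] tend to 1 if [x < 1/2] and
   to 0 if [x > 1/2]. *)
Lemma step_poly_bounds (tau e eta : R) : -1 <= tau <= 1 -> 0 < e -> 0 < eta ->
  exists m, forall c, -1 <= c <= 1 ->
  [/\ 0 <= (step_poly tau m).[c] <= 1,
      tau + eta <= c -> 1 - e <= (step_poly tau m).[c] &
      c <= tau - eta -> (step_poly tau m).[c] <= e].
Proof.
move=> /andP[t1 t2] e0 eta0.
(* Chosen so that m (eta / 2) e >= 1. *)
pose m := (Num.bound (2 / (eta * e))).+1; exists m => c /andP[c1 c2].
have me : 1 <= m%:R * (eta / 2) * e.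
  have h : 2 / (eta * e) <= m%:R.
    have ee0 : 0 <= 2 / (eta * e) by rewrite divr_ge0// ltW// mulr_gt0.
    by apply: le_trans (ltW (archi_boundP ee0)) _; rewrite ler_nat /m leqW.
  by move: h; rewrite ler_pdivrMr ?mulr_gt0//; lra.
rewrite step_polyE; set x := 2^-1 - (c - tau) / 4.
have x01 : 0 <= x <= 1 by rewrite /x; apply/andP; split; lra.
have /andP[x0 x1] := x01.
have xm : 0 <= x ^+ m <= 1 by rewrite exprn_ge0//= exprn_ile1.
have /andP[xm0 xm1] := xm.
have kz : (2 ^ m)%:R * x ^+ m = (2 * x) ^+ m by rewrite natrX exprMn.
have me0 : 0 < m%:R * (eta / 2) by rewrite mulr_gt0// divr_gt0.
split.
- by rewrite exprn_ge0 ?subr_ge0//= exprn_ile1 ?subr_ge0// gerBl.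
- move=> ct; apply: le_trans (expr1B_ge _ xm); rewrite kz lerD2l lerN2.
  (* Above the threshold, (2x)^m <= (1 - eta/2)^m <= 1 / (1 + m eta/2) <= e. *)
  have h1 : 2 * x <= 1 - eta / 2 by rewrite /x; lra.
  apply: (@le_trans _ _ ((1 - eta / 2) ^+ m)).
    by rewrite lerXn2r ?nnegrE//; [lra|apply: le_trans h1; lra].
  have eta2 : 0 <= eta / 2 <= 1 by apply/andP; split; lra.
  have := expr1B_le m eta2.
  set w := (1 - eta / 2) ^+ m => hw.
  have w0 : 0 <= w by rewrite exprn_ge0//; lra.
  nra.
- move=> ct; have := expr1B_le (2 ^ m) xm; rewrite kz.
  set w := (1 - x ^+ m) ^+ (2 ^ m) => hw.
  have w0 : 0 <= w by rewrite exprn_ge0// subr_ge0.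
  (* Below the threshold, (2x)^m >= m eta/2 >= 1 / e, and the value is at most 1 / (1 + (2x)^m). *)
  have h1 : 1 + eta / 2 <= 2 * x by rewrite /x; lra.
  have h2 : m%:R * (eta / 2) <= (2 * x) ^+ m.
    apply: (@le_trans _ _ ((1 + eta / 2) ^+ m)); last first.
      by rewrite lerXn2r ?nnegrE//; [lra|apply: le_trans h1; lra].
    elim: (m) => [|k IH]; first by rewrite mul0r expr0.
    rewrite exprS -natr1 mulrDl mul1r mulrDl mul1r.
    have : 1 <= (1 + eta / 2) ^+ k by rewrite exprn_ege1//; lra.
    move: IH; set v := (1 + eta / 2) ^+ k; set s := _%:R * _ => a b.
    by nra.
  by nra.
Qed.

End step_polynomial.

(** * Weyl's criterion for the phase of the characteristic polynomial *)

Section weyl.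
Variable R : realType.
Variable haar : forall N : nat, probability (borel_unitary R N) R.
Hypothesis haarP : forall N, is_haar (haar N).
Variables (B x0 : R).
Hypothesis B_gt1 : 1 < B.

(** The angle 2 pi log_B z measured from [x0]; for z > 0 its class modulo 2 pi depends only on the
    mantissa. *)
Definition phase (z : R) : R := pi *+ 2 / ln B * ln z - x0.

(** The value 0 at z = 0 agrees with the mantissa 0, which lies outside [1, s]. *)
Definition at_phase (f : R -> R) (z : R) : R := if z == 0 then 0 else f (phase z).

Definition phase_mean (n : nat) (f : R -> R) : R :=
  \int[haar n]_U at_phase f (unitaryZ U).

(* [c] is the mean of [f] over a period, expressed by a primitive [F]. *)
Definition weyl (f : R -> R) (c : R) := [/\ bmeas f,
  (exists2 F : R -> R, (forall y : R, is_derive y 1 F (f y)) &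
     forall y, F (y + pi *+ 2) = F y + pi *+ 2 * c) &
  phase_mean n f @[n --> \oo] --> c].

Lemma bmeas_at_phase f : bmeas f -> bmeas (at_phase f).
Proof.
move=> [mf [M fM]]; apply: (bmeas_bound (M := `|M|)) => [|z].
  apply: measurable_if_eq0; apply: (measurableT_comp mf).
  apply: measurable_funB; last exact: measurable_cst.
  by apply: measurable_funM; [exact: measurable_cst|exact: measurable_ln].
rewrite /at_phase; case: ifP => _; first by rewrite normr0.
by apply: le_trans (fM _) _; exact: ler_norm.
Qed.

Let bphase n f (bf : bmeas f) :=
  bmeas_comp (@measurable_unitaryZ R n) (bmeas_at_phase bf).

Lemma weylD f g c e : weyl f c -> weyl g e -> weyl (fun y => f y + g y) (c + e).
Proof.
move=> [bf [F dF FT] cf] [bg [G dG GT] cg]; split; first exact: bmeasD.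
  exists (F + G) => y; last by rewrite /= !fctE FT GT; ring.
  exact: is_deriveD.
rewrite (_ : (fun n => _) = (fun n => phase_mean n f + phase_mean n g)).
  exact: cvgD.
apply/funext => n; rewrite /phase_mean -prob_intD; try exact: bphase.
by apply: eq_Rintegral => U _; rewrite /at_phase; case: ifP; rewrite ?addr0.
Qed.

Lemma weylZ a f c : weyl f c -> weyl (fun y => a * f y) (a * c).
Proof.
move=> [bf [F dF FT] cf]; split; first exact: bmeasZ.
  exists (a \*: (F : R -> R^o)) => y; last by rewrite /= FT /GRing.scale /=; ring.
  exact: is_deriveZ.
rewrite (_ : (fun n => _) = (fun n => a * phase_mean n f)).
  by apply: cvgMr.
apply/funext => n; rewrite /phase_mean -prob_intZ; last exact: bphase.
by apply: eq_Rintegral => U _; rewrite /at_phase; case: ifP; rewrite ?mulr0.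
Qed.

Lemma sqr_sum_cvg0 (u v : nat -> R) :
  u n ^+ 2 + v n ^+ 2 @[n --> \oo] --> 0 -> u @ \oo --> 0 /\ v @ \oo --> 0.
Proof.
move=> h; split; apply/cvgr0Pnorm_lt => e e0;
  have /cvgr0Pnorm_lt/(_ (e ^+ 2)) := h;
  move=> /(_ (exprn_gt0 _ e0)); apply: filterS => n.
- move=> hn; rewrite -(@ltr_pXn2r _ 2)// ?nnegrE// ?(ltW e0)//.
  apply: le_lt_trans hn; rewrite real_normK ?num_real// ger0_norm.
    by rewrite lerDl sqr_ge0.
  by rewrite addr_ge0// sqr_ge0.
- move=> hn; rewrite -(@ltr_pXn2r _ 2)// ?nnegrE// ?(ltW e0)//.
  apply: le_lt_trans hn; rewrite real_normK ?num_real// ger0_norm.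
    by rewrite lerDr sqr_ge0.
  by rewrite addr_ge0// sqr_ge0.
Qed.

Lemma bmeas_cosZ (h : R) : bmeas (fun y : R => cos (h * y)).
Proof.
apply: (bmeas_bound (M := 1)) => [|x]; last exact: cos_max.
apply: (measurableT_comp (f := @cos R)).
  by apply: continuous_measurable_fun; exact: continuous_cos.
exact: measurable_funM.
Qed.

(** The mean is a combination of [cosZ] and [sinZ] at t = 2 pi h / ln B. It tends to 0 for h <> 0;
    for h = 0 it is the probability 1 that Z_n is nonzero. *)
Lemma weyl_cos (h : nat) : weyl (fun y => cos (h%:R * y)) (h == 0%N)%:R.
Proof.
have lB : ln B != 0 by rewrite gt_eqF// ln_gt0.
split; first exact: bmeas_cosZ.
  case: h => [|h].
    exists id => y; last by rewrite /= mulr1.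
    by rewrite mul0r cos0; exact: is_derive_id.
  exists (fun y => h.+1%:R^-1 * sin (h.+1%:R * y)) => y; last first.
    have -> : h.+1%:R * (y + pi *+ 2) = h.+1%:R * y + (pi *+ 2) *+ h.+1 :> R.
      by rewrite mulrDr [X in _ + X]mulr_natl.
    by rewrite (periodicn (@sinD2pi R)) mulr0 addr0.
  have d1 : is_derive y 1 (fun x : R => h.+1%:R * x) h.+1%:R.
    by apply: is_derive_eq; rewrite /GRing.scale /=; ring.
  have d2 := @is_derive1_comp _ sin (fun x : R => h.+1%:R * x) y _ _
    (is_derive_sin _) d1.
  have d3 := is_deriveZ (h.+1%:R^-1) d2.
  apply: (is_derive_eq d3).
  by rewrite /GRing.scale /= mulrC mulfK// pnatr_eq0.
pose t := pi *+ 2 / ln B * h%:R.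
have E n : phase_mean n (fun y => cos (h%:R * y)) =
    cos (h%:R * x0) * cosZ haar t n + sin (h%:R * x0) * sinZ haar t n.
  have bc := bmeas_comp (@measurable_unitaryZ R n) (bmeas_cosln t).
  have bs := bmeas_comp (@measurable_unitaryZ R n) (bmeas_sinln t).
  rewrite /cosZ /sinZ -!prob_intZ// -prob_intD; [|exact: bmeasZ..].
  apply: eq_Rintegral => U _; rewrite /at_phase /cosln /sinln.
  case: ifP => _; first by rewrite !mulr0 addr0.
  rewrite /phase (_ : h%:R * _ = t * ln (unitaryZ U) - h%:R * x0).
    by rewrite cosB; ring.
  by rewrite /t; ring.
rewrite (_ : (fun n => _) = fun n => cos (h%:R * x0) * cosZ haar t n +
    sin (h%:R * x0) * sinZ haar t n); last by apply/funext => n; exact: E.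
case: h @t {E} => [|h] t.
  rewrite /t mulr0 mul0r cos0 sin0.
  rewrite (_ : (fun n => _) = fun=> 1); first exact: cvg_cst.
  by apply/funext => n; rewrite (cosZ0 haarP) mul0r addr0 mulr1.
have t0 : t != 0.
  by rewrite mulf_neq0 ?pnatr_eq0// mulf_neq0 ?invr_eq0// mulrn_eq0 /= gt_eqF// pi_gt0.
have [c0 s0] := sqr_sum_cvg0 (charZ_cvg0 haarP t0).
rewrite [X in _ --> X](_ : _ = cos (h.+1%:R * x0) * 0 + sin (h.+1%:R * x0) * 0).
  by apply: cvgD; apply: cvgMr.
by rewrite !mulr0 addr0.
Qed.

Lemma weyl_ext f g c : f =1 g -> weyl f c -> weyl g c.
Proof. by move=> /funext->. Qed.

(** The extra factor cos (h y) carries the induction: multiplying by cos y shifts h by 1 both ways.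
    The constant stays implicit, since the primitive suffices to bound it. *)
Lemma weyl_poly (p : {poly R}) (h : nat) :
  exists c, weyl (fun y => p.[cos y] * cos (h%:R * y)) c.
Proof.
elim/poly_ind: p h => [|p a IH] h.
  exists (0 * (h == 0%N)%:R); apply: weyl_ext (weylZ 0 (weyl_cos h)) => y.
  by rewrite horner0.
have wa := weylZ a (weyl_cos h).
case: h wa => [|h] wa.
  have [c wc] := IH 1%N; eexists; apply: weyl_ext (weylD wc wa) => y.
  by rewrite !hornerE ?mul1r ?mul0r cos0; ring.
have [c wc] := IH h.+2; have [e we] := IH h.
eexists; apply: weyl_ext (weylD (weylZ 2^-1 (weylD wc we)) wa) => y.
rewrite !hornerE.
have -> : h.+2%:R * y = h.+1%:R * y + y by rewrite -natr1 mulrDl mul1r.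
have -> : h%:R * y = h.+1%:R * y - y by rewrite -natr1 mulrDl mul1r addrK.
by rewrite cosD cosB; field.
Qed.

End weyl.

(** * Asymptotic upper bound for the mass of an arc *)

Section weyl_upper_bound.
Variable R : realType.

Lemma ler_cos_pi (a b : R) : 0 <= a -> a <= b -> b <= pi -> cos b <= cos a.
Proof.
move=> a0; rewrite le_eqVlt => /predU1P[->//|ab] bp.
apply/ltW; rewrite ltr_cos// in_itv /= ?a0 ?bp ?andbT.
  by rewrite (le_trans (ltW ab)).
exact: le_trans (ltW ab).
Qed.

Lemma ltr_cos_pi (a b : R) : 0 <= a -> a < b -> b <= pi -> cos b < cos a.
Proof.
move=> a0 ab bp; rewrite ltr_cos// in_itv /= ?a0 ?bp ?andbT.
  by rewrite (le_trans (ltW ab)).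
exact: le_trans (ltW ab).
Qed.

Lemma primitive_le (F f : R -> R) (K a b : R) : a <= b ->
  (forall y : R, is_derive y 1 F (f y)) ->
  (forall y, a <= y <= b -> f y <= K) -> F b - F a <= K * (b - a).
Proof.
move=> ab dF fK.
have cF : continuous F.
  by move=> y; apply: differentiable_continuous; apply/derivable1_diffP;
     exact: (@ex_derive _ _ _ _ _ _ _ (dF y)).
have [y] := MVT_segment ab (fun y _ => dF y) (continuous_subspaceT cF).
rewrite in_itv /= => yab ->; rewrite ler_wpM2r ?subr_ge0//.
exact: fK.
Qed.

(** For 0 <= u <= 1, the indicator of the arc of half-width pi u about 0, which fills the fraction u
    of the circle; the cosine makes it periodic. *)
Definition arc_ind (u y : R) : R := if cos (pi * u) <= cos y then 1 else 0.

Lemma bmeas_arc_ind u : bmeas (arc_ind u).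
Proof.
apply: (bmeas_bound (M := 1)) => [|y].
  apply: measurable_fun_ifT => //; apply: measurable_fun_ler => //.
  by apply: continuous_measurable_fun; exact: continuous_cos.
by rewrite /arc_ind; case: ifP; rewrite ?normr1// normr0.
Qed.

Variable haar : forall N : nat, probability (borel_unitary R N) R.
Hypothesis haarP : forall N, is_haar (haar N).
Variables (B x0 : R).
Hypothesis B_gt1 : 1 < B.

(** The indicator is at most a step polynomial in the cosine plus [d], and the phase mean of that
    polynomial tends to its mean [c] over a period. *)
Lemma arc_upper (u e : R) : 0 <= u -> 0 < e ->
  \forall n \near \oo, phase_mean haar B x0 n (arc_ind u) <= u + e.
Proof.
move=> u0 e0; have p0 := @pi_gt0 R.
have bphase n f (bf : bmeas f) :=
  bmeas_comp (@measurable_unitaryZ R n) (bmeas_at_phase B x0 bf).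
have [ue|ue] := leP 1 (u + e).
  apply: nearW => n; apply: le_trans ue.
  rewrite -[leRHS](prob_int_cst (haar n)); apply: prob_int_le.
  - exact: bphase (bmeas_arc_ind u).
  - exact: bmeas_cst.
  - move=> U; rewrite /at_phase /arc_ind.
    by case: ifP => _; [exact: ler01|case: ifP => _ //; exact: ler01].
(* The polynomial steps at angle pi u1, is nearly 1 within pi u and nearly 0 beyond pi u2; the
   losses u2 - u + 2 d stay below [e]. *)
pose u1 := u + e / 4; pose u2 := u + e / 2; pose d := e / 8.
have u1p : pi * u1 <= pi by rewrite /u1; nra.
have u2p : pi * u2 <= pi by rewrite /u2; nra.
have u00 : 0 <= pi * u by rewrite mulr_ge0// ltW.
have u01 : pi * u < pi * u1 by rewrite ltr_pM2l// /u1; lra.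
have u12 : pi * u1 < pi * u2 by rewrite ltr_pM2l// /u1 /u2; lra.
have u10 : 0 <= pi * u1 by rewrite (le_trans u00)// ltW.
have u20 : 0 <= pi * u2 by rewrite (le_trans u10)// ltW.
pose tau := cos (pi * u1).
pose eta := Num.min (cos (pi * u) - tau) (tau - cos (pi * u2)).
have eta0 : 0 < eta by rewrite lt_min !subr_gt0 !ltr_cos_pi.
have d0 : 0 < d by rewrite divr_gt0.
have tau1 : -1 <= tau <= 1 by rewrite cos_geN1 cos_le1.
have [m pm] := step_poly_bounds tau1 d0 eta0.
pose g y : R := (step_poly tau m).[cos y].
have cos1 (y : R) : -1 <= cos y <= 1 by rewrite cos_geN1 cos_le1.
have g1 y : g y <= 1 by have [/andP[_ ->]] := pm _ (cos1 y).
have g0 y : 0 <= g y by have [/andP[->]] := pm _ (cos1 y).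
have gi y : arc_ind u y <= g y + d.
  rewrite /arc_ind; case: ifPn => [h|_]; last by rewrite addr_ge0// ltW.
  have [_ + _] := pm _ (cos1 y); rewrite -/(g y) => hg.
  rewrite -lerBlDr; apply: hg; apply: le_trans h.
  by rewrite -lerBrDl /eta ge_min lexx.
have gd y : cos y <= cos (pi * u2) -> g y <= d.
  move=> h; have [_ _] := pm _ (cos1 y); apply; apply: le_trans h _.
  by rewrite lerBrDr -lerBrDl /eta ge_min lexx orbT.
have [c wc] := weyl_poly haarP x0 B_gt1 (step_poly tau m) 0%N.
have {wc} [bg [F dF FT] cg] : weyl haar B x0 g c.
  by apply: weyl_ext wc => y; rewrite mul0r cos0 mulr1.
(* On the period [-pi, pi], cut at -pi u2 and pi u2, the polynomial is at most 1 inside and at most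
   [d] outside; increments of [F] replace integrals. *)
have c_le : c <= u2 + d.
  have := FT (- pi); rewrite (_ : - pi + pi *+ 2 = pi :> R); last first.
    by rewrite mulr2n addrA addNr add0r.
  move=> FE.
  have h1 : F (- (pi * u2)) - F (- pi) <= d * (- (pi * u2) - (- pi)).
    apply: (primitive_le _ dF) => [|y /andP[y1 y2]]; first by rewrite lerN2.
    by apply: gd; rewrite -[cos y]cosN; apply: ler_cos_pi; rewrite // 1?lerNr// lerNl.
  have h2 : F (pi * u2) - F (- (pi * u2)) <= 1 * (pi * u2 - (- (pi * u2))).
    by apply: (primitive_le _ dF) => // ; rewrite (le_trans _ u20)// oppr_le0.
  have h3 : F pi - F (pi * u2) <= d * (pi - pi * u2).
    apply: (primitive_le _ dF) => // y /andP[y1 y2].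
    by apply: gd; exact: ler_cos_pi.
  rewrite mulr2n in FE; rewrite -(@ler_pM2l _ pi)//.
  have : d * (pi - pi * u2) <= d * pi by rewrite ler_wpM2l ?(ltW d0)// gerBl.
  by move: h1 h2 h3 FE; move: (u2) (d) => U2 D; lra.
have hc : c < u + e - d by rewrite /u2 /d in c_le *; lra.
apply: filterS (cvgr_lt c cg _ hc) => n /= hn.
apply: (@le_trans _ _ (phase_mean haar B x0 n g + d)); last by lra.
rewrite -[X in _ + X](prob_int_cst (haar n)) -prob_intD; last 2 first.
- exact: bphase.
- exact: bmeas_cst.
apply: prob_int_le.
- exact: bphase (bmeas_arc_ind u).
- by apply: bmeasD; [exact: bphase|exact: bmeas_cst].
- move=> U; rewrite /at_phase; case: ifP => _; first by rewrite add0r ltW.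
  exact: gi.
Qed.

End weyl_upper_bound.

(** * From mantissas to arcs, and the limit law *)

Section mantissa_arc.
Variable R : realType.

Lemma cosD2piz (x : R) (k : int) : cos (x + pi *+ 2 * k%:~R) = cos x.
Proof.
case: k => k; first by rewrite -pmulrn mulr_natr (periodicn (@cosD2pi R)).
rewrite NegzE mulrNz -pmulrn mulrN mulr_natr.
by have := periodicn (@cosD2pi R) k.+1 (x - pi *+ 2 *+ k.+1); rewrite subrK => ->.
Qed.

(** With r the base-B logarithm of the mantissa, the angle is 2 pi r - pi u modulo 2 pi, so r <= u
    describes the arc of half-width pi u about 0. This dictates the shift pi u. *)
Lemma mantissa_arc (B s z : R) : 1 < B -> 1 <= s < B -> 0 < z ->
  (1 <= mantissa B z <= s) =
  (cos (pi * (ln s / ln B)) <= cos (phase B (pi * (ln s / ln B)) z)).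
Proof.
move=> B1 /andP[s1 sB] z0; have p0 := @pi_gt0 R.
have [/andP[m1 mB] [k zE]] := mantissaP B1 z0.
set M := mantissa B z in m1 mB zE *; rewrite m1 /=.
have lB : 0 < ln B by exact: ln_gt0.
have M0 : 0 < M by exact: lt_le_trans m1.
have s0 : 0 < s by exact: lt_le_trans s1.
have B0 : 0 < B by exact: lt_trans B1.
set u := ln s / ln B; pose r := ln M / ln B.
have -> : (M <= s) = (r <= u) by rewrite /r /u ler_pM2r ?invr_gt0// ler_ln ?posrE.
have u0 : 0 <= u by rewrite divr_ge0 ?ln_ge0// ltW.
have u1 : u < 1 by rewrite /u ltr_pdivrMr// mul1r ltr_ln ?posrE.
have r0 : 0 <= r by rewrite divr_ge0 ?ln_ge0// ltW.
have r1 : r < 1 by rewrite /r ltr_pdivrMr// mul1r ltr_ln ?posrE.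
have lnz : ln z = ln M + k%:~R * ln B.
  rewrite zE lnM ?posrE ?exprz_gt0//; congr (_ + _).
  by rewrite -powR_intmul ?ln_powR// ltW.
have -> : phase B (pi * u) z = (pi *+ 2 * r - pi * u) + pi *+ 2 * k%:~R.
  by rewrite /phase lnz /r; field; rewrite gt_eqF.
rewrite cosD2piz mulr2n; set w := (pi + pi) * r - pi * u.
have u0p : 0 <= pi * u by rewrite mulr_ge0// ltW.
have pr0 : 0 <= pi * r by rewrite mulr_ge0// ltW.
have pu1 : pi * u < pi by rewrite gtr_pMr.
have pr1 : pi * r < pi by rewrite gtr_pMr.
have [ru|ur] := leP r u.
  have pru : pi * r <= pi * u by rewrite ler_pM2l.
  apply/esym; rewrite -[cos w]cos_norm; apply: ler_cos_pi (ltW pu1) => //.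
  by rewrite ler_norml /w; apply/andP; split; lra.
have pru : pi * u < pi * r by rewrite ltr_pM2l.
apply/esym/negbTE; rewrite -ltNge.
have [wp|wp] := leP w pi.
  by apply: ltr_cos_pi => //; rewrite /w; lra.
(* Past pi, use 2 pi - w, which lies strictly between pi u and pi because r < 1. *)
rewrite -[cos w]cosN -(cosD2pi (- w)) mulr2n.
apply: ltr_cos_pi => //; last by lra.
by rewrite /w; lra.
Qed.

End mantissa_arc.

(** U(0) is a single point, so the recursion can start at N = 0, below the range of [haarP]. *)
Lemma is_haar0 (R : realType) (mu : probability (borel_unitary R 0) R) : is_haar mu.
Proof.
move=> V A mA; congr (mu _).
have eqU (U W : unitary R 0) : U = W.
  by apply: unitary_inj; apply/matrixP => -[].
apply/seteqP; split => [_ [U AU <-]|U AU]; first by rewrite (eqU (unitaryM V U) U).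
by exists U.
Qed.

Theorem theoremA2 (R : realType)
  (haar : forall N : nat, probability (borel_unitary R N) R)
  (haarP : forall N : nat, (1 <= N)%N -> is_haar (haar N))
  (theta B s : R) (B_gt1 : 1 < B) (s_bounds : 1 <= s < B) :
  haar N [set U : borel_unitary R N |
            1 <= mantissa B (Normc.normc (charpolyZ U theta)) <= s]
    @[N --> \oo] --> (ln s / ln B)%:E.
Proof.
have haarP' N : is_haar (haar N).
  by case: N => [|N]; [exact: is_haar0|exact: haarP].
have lB : 0 < ln B by exact: ln_gt0.
have /andP[s1 sB] := s_bounds.
have s0 : 0 < s by exact: lt_le_trans s1.
pose u := ln s / ln B.
have u0 : 0 <= u by rewrite divr_ge0 ?ln_ge0// ltW.
have u1 : u <= 1.
  by rewrite /u ler_pdivrMr// mul1r ler_ln ?posrE ?(ltW sB)// (lt_trans _ B_gt1).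
pose f z := at_phase B (pi * u) (arc_ind u) z.
have bf n : bmeas (fun U : borel_unitary R n => f (unitaryZ U)).
  exact: bmeas_comp (@measurable_unitaryZ R n) (bmeas_at_phase _ _ (bmeas_arc_ind u)).
pose S n : set (borel_unitary R n) := [set U | 1 <= mantissa B (unitaryZ U) <= s].
(* At Z = 0 both conditions fail; elsewhere [mantissa_arc] identifies them. *)
have SE n : S n = (fun U => f (unitaryZ U)) @^-1` [set 1].
  apply/seteqP; split => U; rewrite /S /f /at_phase /=.
    case: ifP => [/eqP->|Z0]; first by rewrite /mantissa ltxx ler10.
    rewrite mantissa_arc// ?lt_neqAle ?unitaryZ_ge0 1?eq_sym ?Z0// => h.
    by rewrite /arc_ind h.
  case: ifP => [_ /esym/eqP|Z0]; first by rewrite oner_eq0.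
  rewrite mantissa_arc// ?lt_neqAle ?unitaryZ_ge0 1?eq_sym ?Z0//.
  by rewrite /arc_ind; case: ifP => // _ /esym/eqP; rewrite oner_eq0.
have mS n : measurable (S n).
  by rewrite SE -[X in measurable X]setTI; apply: (bf n).1.
have f01 z : f z = 0 \/ f z = 1.
  by rewrite /f /at_phase /arc_ind; case: ifP => _; [left|case: ifP; [right|left]].
have PS n : haar n (S n) = (phase_mean haar B (pi * u) n (arc_ind u))%:E.
  rewrite -prob_int_indic//; congr EFin; apply: eq_Rintegral => U _.
  rewrite indicE; case: (boolP (U \in S n)) => h.
    by have := set_mem h; rewrite SE /= /f => ->.
  have [] := f01 (unitaryZ U) => // h1; exfalso; move/negP: h; apply.
  by apply/mem_set; rewrite SE.
(* The angle enters only through the scalar unitary e^(-i theta), which invariance removes. *)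
have PE n : haar n [set U : borel_unitary R n |
    1 <= mantissa B (Normc.normc (charpolyZ U theta)) <= s] = haar n (S n).
  have t1 : Normc.normc (cos (- theta) +i* sin (- theta))%C = 1 :> R.
    by rewrite /= cos2Dsin2 sqrtr1.
  rewrite (_ : [set U | _] = unitaryM (uscal n t1) @^-1` S n).
    exact: haar_preimage.
  by apply/seteqP; split => U; rewrite /S /= /unitaryZ /charpolyZ /= mul_scalar_mx.
under eq_cvg do rewrite PE PS.
apply: cvg_EFin; first exact: nearW.
apply/cvgrPdist_le => e e0; rewrite /= -/u.
have up := arc_upper haarP' (pi * u) B_gt1 u0 e0.
(* The lower bound is the upper bound for the opposite arc, shifted by pi and filling the fraction 1
   - u. *)
have lo := arc_upper haarP' (pi * u + pi) B_gt1 (_ : 0 <= 1 - u) e0.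
have {}lo := lo ltac:(by rewrite subr_ge0).
near=> n.
have hu : phase_mean haar B (pi * u) n (arc_ind u) <= u + e by near: n.
have hl : phase_mean haar B (pi * u + pi) n (arc_ind (1 - u)) <= 1 - u + e.
  by near: n.
have b2 : bmeas (fun U : borel_unitary R n =>
    at_phase B (pi * u + pi) (arc_ind (1 - u)) (unitaryZ U)).
  exact: bmeas_comp (@measurable_unitaryZ R n)
    (bmeas_at_phase _ _ (bmeas_arc_ind (1 - u))).
(* The two closed arcs cover the circle, so their means add up to at least the probability 1 that
   Z_n is nonzero. *)
have h1 : 1 <= phase_mean haar B (pi * u) n (arc_ind u) +
    phase_mean haar B (pi * u + pi) n (arc_ind (1 - u)).
  apply: (@le_trans _ _ (\int[haar n]_U (f (unitaryZ U) +
      at_phase B (pi * u + pi) (arc_ind (1 - u)) (unitaryZ U)))); last first.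
    by rewrite (prob_intD (haar n) (bf n) b2).
  rewrite -[leLHS](cosZ0 haarP' n).
  apply: prob_int_le.
  - exact: bmeas_comp (@measurable_unitaryZ R n) (bmeas_cosln 0).
  - exact: (bmeasD (bf n) b2).
  - move=> U; rewrite /f /cosln /at_phase; case: ifP => _; first by rewrite addr0.
    rewrite mul0r cos0 /arc_ind.
    have cosBpi y : cos (y - pi) = - cos y :> R.
      by rewrite cosB cospi sinpi mulr0 addr0 mulrN1.
    have -> : cos (pi * (1 - u)) = - cos (pi * u).
      by rewrite -cosBpi -[RHS]cosN opprB mulrBr mulr1.
    have -> : cos (phase B (pi * u + pi) (unitaryZ U)) =
        - cos (phase B (pi * u) (unitaryZ U)).
      by rewrite -cosBpi /phase opprD addrA.
    rewrite lerN2; set w := cos (phase _ _ _).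
    have [_|/ltW ->] := leP (cos (pi * u)) w; last by rewrite add0r.
    by rewrite lerDl; case: ifP.
rewrite ler_distl; apply/andP; split; lra.
Unshelve. all: by end_near. Qed.
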